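(* Let $\Bbbk$ be a field of characteristic zero, let $S=\Bbbk[x]$, let $h\in S$ be nonzero and let $A_h$ be the algebra $\Bbbk\langle x,y\rangle/(yx-xy-h)$. Let $d$ be the greatest common divisor of $h$ and its derivative $h'$, and let $I$ be the ideal of $S/(h)$ generated by the class of $h/d$. There are isomorphisms of vector spaces $$HH^i(A_h)\cong\begin{cases}\Bbbk & \text{if } i=0;\\ S/(h)\oplus I[y] & \text{if } i=1;\\ \dfrac{S}{(d)}[y] & \text{if } i=2;\\ 0 & \text{otherwise.}\end{cases}$$
   Context: $HH^\bullet(A)=\mathrm{Ext}^\bullet_{A^e}(A,A)$ is the Hochschild cohomology of an associative algebra $A$, where $A^e=A\otimes A^{\mathrm{op}}$. $I[y]$ denotes the space of polynomials in $y$ with coefficients in $I$, and $\frac{S}{(d)}[y]$ the space of polynomials in $y$ with coefficients in $S/(d)$. *)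

(* Defs.v *)
From HB Require Import structures.
From mathcomp Require Import all_boot all_algebra.
From mathcomp Require Import finmap boolp functions.
From mathcomp Require Import ring.
From mathcomp.multinomials Require Import monalg.

Set Implicit Arguments.
Unset Strict Implicit.
Unset Printing Implicit Defensive.

Import GRing.Theory.
Local Open Scope ring_scope.
Local Open Scope quotient_scope.

Record submodule (R : pzRingType) (V : lmodType R) := Submodule {
  in_submodule :> V -> Prop;
  submodule0 : in_submodule 0;
  submoduleP : forall (a : R) (u v : V),
    in_submodule u -> in_submodule v -> in_submodule (a *: u + v) }.

Section SubmoduleTheory.
Variables (R : pzRingType) (V : lmodType R) (U : submodule V).

Lemma submoduleD u v : U u -> U v -> U (u + v).
Proof. by move=> Uu Uv; rewrite -[u]scale1r; exact: submoduleP. Qed.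

Lemma submoduleZ a u : U u -> U (a *: u).
Proof. by move=> Uu; rewrite -[_ *: _]addr0; exact/submoduleP/submodule0. Qed.

Lemma submoduleN u : U u -> U (- u).
Proof. by move=> Uu; rewrite -scaleN1r; exact: submoduleZ. Qed.

Lemma submoduleB u v : U u -> U v -> U (u - v).
Proof. by move=> Uu Uv; exact/submoduleD/submoduleN. Qed.

Definition submodule_pred : {pred V} := fun x => `[< U x >].

Lemma submodule_predP x : reflect (U x) (x \in submodule_pred).
Proof. exact: asboolP. Qed.

Fact submodule_pred_closed : GRing.subsemimod_closed submodule_pred.
Proof.
have cl : GRing.submod_closed submodule_pred.
  split; first by apply/submodule_predP/submodule0.
  move=> a u v /submodule_predP Uu /submodule_predP Uv.
  by apply/submodule_predP/submoduleP.
exact: cl.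
Qed.

HB.instance Definition _ :=
  GRing.isSubmodClosed.Build R V submodule_pred submodule_pred_closed.

Record submodule_type := SubmoduleType {
  submodule_val : V; _ : submodule_val \in submodule_pred }.
HB.instance Definition _ := [isSub for submodule_val].
HB.instance Definition _ := [Choice of submodule_type by <:].
HB.instance Definition _ :=
  [SubChoice_isSubLmodule of submodule_type by <:].

Lemma submodule_valP (x : submodule_type) : U (val x).
Proof. exact/submodule_predP/valP. Qed.

Definition in_sub (x : V) (Ux : U x) : submodule_type :=
  SubmoduleType (introT (submodule_predP x) Ux).

Definition quotient_module := Quotient.quot submodule_pred.
HB.instance Definition _ := GRing.Zmodule.on quotient_module.

Definition quot_class (x : V) : quotient_module :=
  \pi_(Quotient.quot submodule_pred) x.

Lemma quot_classP x y : quot_class x = quot_class y <-> U (x - y).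
Proof.
split=> [/eqP|].
  by rewrite /quot_class -Quotient.idealrBE => /submodule_predP.
move=> /submodule_predP Uxy; apply/eqP.
by rewrite /quot_class -Quotient.idealrBE.
Qed.

Lemma quot_class_surj (q : quotient_module) : exists x, q = quot_class x.
Proof. by exists (repr (q : Quotient.quot submodule_pred)); rewrite /quot_class reprK. Qed.

Lemma quot_class_is_zmod_morphism : zmod_morphism quot_class.
Proof. exact: (@pi_is_zmod_morphism _ _ _ (Quotient.quot submodule_pred)). Qed.

HB.instance Definition _ :=
  GRing.isZmodMorphism.Build V quotient_module quot_class
    quot_class_is_zmod_morphism.

Definition quot_lift (W : Type) (f : V -> W) (q : quotient_module) : W :=
  f (repr (q : Quotient.quot submodule_pred)).

Lemma quot_liftE (W : Type) (f : V -> W) :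
    (forall x y, U (x - y) -> f x = f y) ->
  forall x, quot_lift f (quot_class x) = f x.
Proof.
move=> fP x; apply: fP; apply/quot_classP.
by rewrite /quot_class reprK.
Qed.

Definition quot_scale (a : R) : quotient_module -> quotient_module :=
  quot_lift (fun x => quot_class (a *: x)).

Lemma quot_scaleE a x : quot_scale a (quot_class x) = quot_class (a *: x).
Proof.
apply: (quot_liftE (f := fun x => quot_class (a *: x))) => y z Uyz.
by apply/quot_classP; rewrite -scalerBr; exact: submoduleZ.
Qed.

Fact quot_scaleA a b q : quot_scale a (quot_scale b q) = quot_scale (a * b) q.
Proof. by have [x ->] := quot_class_surj q; rewrite !quot_scaleE scalerA. Qed.

Fact quot_scale1 : left_id 1 quot_scale.
Proof. by move=> q; have [x ->] := quot_class_surj q; rewrite quot_scaleE scale1r. Qed.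

Fact quot_scaleDr : right_distributive quot_scale +%R.
Proof.
move=> a p q; have [x ->] := quot_class_surj p; have [y ->] := quot_class_surj q.
by rewrite -raddfD !quot_scaleE scalerDr raddfD.
Qed.

Fact quot_scaleDl q : {morph quot_scale^~ q : a b / a + b}.
Proof.
by move=> a b /=; have [x ->] := quot_class_surj q; rewrite !quot_scaleE -raddfD scalerDl.
Qed.

HB.instance Definition _ := GRing.Zmodule_isLmodule.Build R quotient_module
  quot_scaleA quot_scale1 quot_scaleDr quot_scaleDl.

Lemma quot_class_is_scalable : scalable quot_class.
Proof. by move=> a x; rewrite -quot_scaleE. Qed.

HB.instance Definition _ :=
  GRing.isScalable.Build R V quotient_module *:%R quot_class
    quot_class_is_scalable.

End SubmoduleTheory.

(* fsupp T V is the direct sum of copies of V indexed by T. It is a fresh name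
   for {malg V[T]} because the library scales {malg V[T]} only when V is the
   ring of scalars. *)
Section FiniteSupport.
Variables (R : pzRingType) (T : choiceType) (V : lmodType R).

Definition fsupp := {malg V[T]}.
HB.instance Definition _ := GRing.Zmodule.on fsupp.

Definition fsupp_scale (a : R) (g : fsupp) : fsupp :=
  \sum_(t <- msupp g) << a *: g@_t *g t >>.

Lemma fsupp_scaleE a g t : (fsupp_scale a g)@_t = a *: g@_t.
Proof.
rewrite /fsupp_scale raddf_sum [in RHS](monalgE g) raddf_sum scaler_sumr.
by apply/eq_bigr=> /= i _; rewrite !mcoeffU scalerMnr.
Qed.

Fact fsupp_scaleA a b g : fsupp_scale a (fsupp_scale b g) = fsupp_scale (a * b) g.
Proof. by apply/malgP=> t; rewrite !fsupp_scaleE scalerA. Qed.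

Fact fsupp_scale1 : left_id 1 fsupp_scale.
Proof. by move=> g; apply/malgP=> t; rewrite fsupp_scaleE scale1r. Qed.

Fact fsupp_scaleDr : right_distributive fsupp_scale +%R.
Proof.
by move=> a g1 g2; apply/malgP=> t; rewrite mcoeffD !fsupp_scaleE mcoeffD scalerDr.
Qed.

Fact fsupp_scaleDl g : {morph fsupp_scale^~ g : a b / a + b}.
Proof. by move=> a b /=; apply/malgP=> t; rewrite mcoeffD !fsupp_scaleE scalerDl. Qed.

HB.instance Definition _ := GRing.Zmodule_isLmodule.Build R fsupp
  fsupp_scaleA fsupp_scale1 fsupp_scaleDr fsupp_scaleDl.

Lemma fsuppZE a (g : fsupp) t : (a *: g)@_t = a *: g@_t.
Proof. exact: fsupp_scaleE. Qed.

End FiniteSupport.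

Definition free_module (R : pzRingType) (T : choiceType) := fsupp T R^o.
HB.instance Definition _ (R : pzRingType) (T : choiceType) :=
  GRing.Lmodule.on (free_module R T).

Section FreeModule.
Variables (R : pzRingType) (T : choiceType).

Definition free_gen (t : T) : free_module R T := << (1 : R^o) *g t >>.

Lemma free_moduleE (g : free_module R T) :
  g = \sum_(t <- msupp g) (g@_t : R) *: free_gen t.
Proof.
rewrite [LHS]monalgE; apply: eq_bigr => t _; apply/malgP => u.
rewrite fsuppZE /free_gen !mcoeffU; case: eqP => _; rewrite ?mulr1n ?mulr0n ?scaler0 //.
by rewrite [RHS]mulr1.
Qed.

Variables (M : lmodType R) (phi : T -> M).

Definition free_lift (g : free_module R T) : M :=
  \sum_(t <- msupp g) (g@_t : R) *: phi t.

Lemma free_liftEw (D : {fset T}) (g : free_module R T) :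
  (msupp g `<=` D)%fset -> free_lift g = \sum_(t <- D) (g@_t : R) *: phi t.
Proof.
move=> le; rewrite /free_lift; apply: big_fset_incl => //= t _ /mcoeff_outdom ->.
by rewrite scale0r.
Qed.

Lemma free_lift_gen t : free_lift (free_gen t) = phi t.
Proof.
by rewrite (free_liftEw msuppU_le) big_seq_fset1 mcoeffUU scale1r.
Qed.

Fact free_lift_is_linear : linear free_lift.
Proof.
move=> a f g; pose D := (msupp (a *: f + g) `|` msupp f `|` msupp g)%fset.
have [] : [/\ msupp (a *: f + g) `<=` D, msupp f `<=` D & msupp g `<=` D]%fset.
  by split; apply/fsubsetP => t; rewrite !inE => ->; rewrite ?orbT.
move=> /free_liftEw -> /free_liftEw -> /free_liftEw ->.
rewrite scaler_sumr -big_split /=; apply: eq_bigr => t _.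
by rewrite mcoeffD fsuppZE scalerDl scalerA.
Qed.

HB.instance Definition _ :=
  GRing.isLinear.Build R (free_module R T) M *:%R free_lift free_lift_is_linear.

End FreeModule.

Section Submodules.
Variables (R : pzRingType) (V W : lmodType R).

Inductive in_span (X : V -> Prop) : V -> Prop :=
| SpanGen x of X x : in_span X x
| Span0 : in_span X 0
| SpanLin a u v of in_span X u & in_span X v : in_span X (a *: u + v).

Definition span_submodule (X : V -> Prop) : submodule V :=
  Submodule (Span0 X) (@SpanLin X).

Variable f : {linear V -> W}.

Fact ker_submodule0 : f 0 = 0. Proof. exact: raddf0. Qed.
Fact ker_submoduleP a u v : f u = 0 -> f v = 0 -> f (a *: u + v) = 0.
Proof. by move=> fu fv; rewrite linearP fu fv scaler0 addr0. Qed.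
Definition ker_submodule : submodule V := Submodule ker_submodule0 ker_submoduleP.

Fact im_submodule0 : exists x, f x = 0. Proof. by exists 0; rewrite raddf0. Qed.
Fact im_submoduleP a u v :
  (exists x, f x = u) -> (exists x, f x = v) -> exists x, f x = a *: u + v.
Proof. by move=> [x <-] [y <-]; exists (a *: x + y); rewrite linearP. Qed.
Definition im_submodule : submodule W := Submodule im_submodule0 im_submoduleP.

Fact zero_submodule0 : (0 : V) = 0. Proof. by []. Qed.
Fact zero_submoduleP (a : R) (u v : V) : u = 0 -> v = 0 -> a *: u + v = 0.
Proof. by move=> -> ->; rewrite scaler0 addr0. Qed.
Definition zero_submodule : submodule V :=
  Submodule zero_submodule0 zero_submoduleP.

Definition lin_iso : Prop := exists g : {linear V -> W}, bijective g.

End Submodules.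

(* The two-sided ideal generated by X. *)
Inductive in_ideal (A : pzRingType) (X : A -> Prop) : A -> Prop :=
| IdealGen x of X x : in_ideal X x
| Ideal0 : in_ideal X 0
| IdealD x y of in_ideal X x & in_ideal X y : in_ideal X (x + y)
| IdealM a x b of in_ideal X x : in_ideal X (a * x * b).

(* A/(X) may be the zero ring, so in general it is only a pzRingType with a
   compatible k-module structure and not an algType. *)
Section IdealQuotient.
Variables (k : pzRingType) (A : algType k) (X : A -> Prop).

Fact ideal_submoduleP (c : k) x y :
  in_ideal X x -> in_ideal X y -> in_ideal X (c *: x + y).
Proof.
move=> Ix Iy; apply: IdealD => //.
have -> : c *: x = (c *: 1) * x * 1 by rewrite mulr1 -scalerAl mul1r.
exact: IdealM.
Qed.

Definition ideal : submodule A := Submodule (Ideal0 X) ideal_submoduleP.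

Definition ideal_quotient := quotient_module ideal.
HB.instance Definition _ := GRing.Lmodule.on ideal_quotient.

Definition ideal_class (a : A) : ideal_quotient := quot_class ideal a.
Fact ideal_class_is_linear : linear ideal_class.
Proof. exact: (linearP (quot_class ideal)). Qed.
HB.instance Definition _ :=
  GRing.isLinear.Build k A ideal_quotient *:%R ideal_class ideal_class_is_linear.

Lemma ideal_classP a b : ideal_class a = ideal_class b <-> in_ideal X (a - b).
Proof. exact: quot_classP. Qed.

Lemma ideal_class_surj (q : ideal_quotient) : exists a, q = ideal_class a.
Proof. exact: quot_class_surj. Qed.

Definition idealq_mul (p q : ideal_quotient) : ideal_quotient :=
  quot_lift (fun a => quot_lift (fun b => ideal_class (a * b)) q) p.

Lemma idealq_mulE a b :
  idealq_mul (ideal_class a) (ideal_class b) = ideal_class (a * b).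
Proof.
have E a' : quot_lift (fun b => ideal_class (a' * b)) (ideal_class b)
            = ideal_class (a' * b).
  apply: (quot_liftE (f := fun b => ideal_class (a' * b))) => x y Ixy.
  by apply/ideal_classP; rewrite -mulrBr -[_ * _]mulr1; exact: IdealM.
rewrite /idealq_mul (quot_liftE (f := fun a => quot_lift _ _)) ?E // => x y Ixy.
by rewrite !E; apply/ideal_classP; rewrite -mulrBl -[x - y]mul1r; exact: IdealM.
Qed.

Fact idealq_mulA : associative idealq_mul.
Proof.
move=> p q r; have [x ->] := ideal_class_surj p; have [y ->] := ideal_class_surj q.
by have [z ->] := ideal_class_surj r; rewrite !idealq_mulE mulrA.
Qed.

Fact idealq_mul1l : left_id (ideal_class 1) idealq_mul.
Proof. by move=> p; have [x ->] := ideal_class_surj p; rewrite idealq_mulE mul1r. Qed.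

Fact idealq_mul1r : right_id (ideal_class 1) idealq_mul.
Proof. by move=> p; have [x ->] := ideal_class_surj p; rewrite idealq_mulE mulr1. Qed.

Fact idealq_mulDl : left_distributive idealq_mul +%R.
Proof.
move=> p q r; have [x ->] := ideal_class_surj p; have [y ->] := ideal_class_surj q.
have [z ->] := ideal_class_surj r.
by rewrite -raddfD !idealq_mulE mulrDl raddfD.
Qed.

Fact idealq_mulDr : right_distributive idealq_mul +%R.
Proof.
move=> p q r; have [x ->] := ideal_class_surj p; have [y ->] := ideal_class_surj q.
have [z ->] := ideal_class_surj r.
by rewrite -raddfD !idealq_mulE mulrDr raddfD.
Qed.

HB.instance Definition _ := GRing.Zmodule_isPzRing.Build ideal_quotient
  idealq_mulA idealq_mul1l idealq_mul1r idealq_mulDl idealq_mulDr.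

Lemma ideal_class1 : ideal_class 1 = 1. Proof. by []. Qed.

Lemma ideal_classM a b : ideal_class (a * b) = ideal_class a * ideal_class b.
Proof. by rewrite -idealq_mulE. Qed.

HB.instance Definition _ := GRing.isMonoidMorphism.Build A ideal_quotient
  ideal_class (conj ideal_class1 ideal_classM).

Fact idealq_scalerAl c (p q : ideal_quotient) : c *: (p * q) = (c *: p) * q.
Proof.
have [x ->] := ideal_class_surj p; have [y ->] := ideal_class_surj q.
by rewrite -[c *: ideal_class x]linearZ -!ideal_classM -[LHS]linearZ scalerAl.
Qed.

Fact idealq_scalerAr c (p q : ideal_quotient) : c *: (p * q) = p * (c *: q).
Proof.
have [x ->] := ideal_class_surj p; have [y ->] := ideal_class_surj q.
by rewrite -[c *: ideal_class y]linearZ -!ideal_classM -[LHS]linearZ scalerAr.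
Qed.

Fact ideal_quotient_submoduleP (Y : ideal_quotient -> Prop) (c : k) (x y : ideal_quotient) :
  in_ideal Y x -> in_ideal Y y -> in_ideal Y (c *: x + y : ideal_quotient).
Proof.
move=> Ix Iy; apply: IdealD => //.
have -> : c *: x = (c *: (1 : ideal_quotient)) * x * (1 : ideal_quotient) by rewrite mulr1 -idealq_scalerAl mul1r.
exact: IdealM.
Qed.

Definition ideal_of_quotient (Y : ideal_quotient -> Prop) :
  submodule ideal_quotient := Submodule (Ideal0 Y) (@ideal_quotient_submoduleP Y).

End IdealQuotient.

(* Noncommutative polynomials with letters in I. The fresh name carries the
   algType structure, absent from {malg k[_]} over noncommutative monoids. *)
Definition free_algebra (k : comNzRingType) (I : choiceType) := {malg k[{fmonom I}]}.

Section FreeAlgebra.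
Variables (k : comNzRingType) (I : choiceType).

HB.instance Definition _ := GRing.Lalgebra.on (free_algebra k I).

Fact malg_scalerAr (K : monomType) (c : k) (f g : {malg k[K]}) :
  c *: (f * g) = f * (c *: g).
Proof.
have comm : f * c%:MP = c%:MP * f.
  rewrite !malgM_def fgmulgU fgmulUg; apply: eq_bigr => w _.
  by rewrite mulrC mulm1 mul1m.
by rewrite -[LHS]mul_malgC -(mul_malgC c g) [RHS]mulrA comm [LHS]mulrA.
Qed.

Fact free_algebra_scalerAr (c : k) (f g : free_algebra k I) :
  c *: (f * g) = f * (c *: g).
Proof. exact: malg_scalerAr. Qed.

HB.instance Definition _ :=
  GRing.Lalgebra_isAlgebra.Build k (free_algebra k I) free_algebra_scalerAr.

Definition free_algebra_gen (i : I) : free_algebra k I := << fmu i >>.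

End FreeAlgebra.

Section FreeAlgebraAction.
Variables (k : comNzRingType) (I : choiceType) (M : lmodType k).
Variable (phi : I -> M -> M).
Hypothesis phi_linear : forall i, linear (phi i).

Definition word_action (w : {fmonom I}) (m : M) : M :=
  foldr (fun i => phi i) m w.

Definition free_action (f : free_algebra k I) (m : M) : M :=
  \sum_(w <- msupp f) f@_w *: word_action w m.

Lemma word_actionM w1 w2 m :
  word_action (mmul w1 w2) m = word_action w1 (word_action w2 m).
Proof. by rewrite /word_action fmM foldr_cat. Qed.

Lemma word_action_linear w : linear (word_action w).
Proof.
move=> a m n; rewrite /word_action; elim: (w : seq I) => //= i s ->.
exact: phi_linear.
Qed.

Lemma free_actionEw (D : {fset {fmonom I}}) (f : free_algebra k I) m :
  (msupp f `<=` D)%fset -> free_action f m = \sum_(w <- D) f@_w *: word_action w m.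
Proof.
move=> le; rewrite /free_action; apply: big_fset_incl => //= t _ /mcoeff_outdom ->.
by rewrite scale0r.
Qed.

Lemma free_actionB m : zmod_morphism (free_action^~ m).
Proof.
move=> f g; pose D := (msupp (f - g) `|` msupp f `|` msupp g)%fset.
have [] : [/\ msupp (f - g) `<=` D, msupp f `<=` D & msupp g `<=` D]%fset.
  by split; apply/fsubsetP => t; rewrite !inE => ->; rewrite ?orbT.
move=> /(free_actionEw m) -> /(free_actionEw m) -> /(free_actionEw m) ->.
rewrite -sumrB /=; apply: eq_bigr => t _.
by rewrite mcoeffB scalerBl.
Qed.

Lemma free_action0l m : free_action 0 m = 0.
Proof. by rewrite -(subrr 0) free_actionB subrr. Qed.

Lemma free_actionD m : {morph free_action^~ m : f g / f + g}.
Proof.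
by move=> f g /=; rewrite -{1}[g]opprK -[- g]sub0r !free_actionB free_action0l sub0r opprK.
Qed.

Lemma free_action_sum (J : Type) (s : seq J) (F : J -> free_algebra k I) m :
  free_action (\sum_(j <- s) F j) m = \sum_(j <- s) free_action (F j) m.
Proof. by apply: (big_morph (free_action^~ m)); [exact: free_actionD|exact: free_action0l]. Qed.

Lemma free_action_linear f : linear (free_action f).
Proof.
move=> a m n; rewrite /free_action scaler_sumr -big_split; apply: eq_bigr => w _.
by rewrite word_action_linear scalerDr !scalerA mulrC.
Qed.

Lemma free_action0r f : free_action f 0 = 0.
Proof. by have := free_action_linear f (-1) 0 0; rewrite scaler0 addr0 scaleN1r addNr. Qed.

Lemma free_actionU c w m : free_action << c *g w >> m = c *: word_action w m.
Proof. by rewrite (free_actionEw _ msuppU_le) big_seq_fset1 mcoeffUU. Qed.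

Lemma free_action1 m : free_action 1 m = m.
Proof. by rewrite free_actionU scale1r /word_action fm1. Qed.

Lemma free_action_gen i m : free_action (free_algebra_gen k i) m = phi i m.
Proof. by rewrite free_actionU scale1r /word_action fmU. Qed.

Lemma free_actionZ c f m : free_action (c *: f) m = c *: free_action f m.
Proof.
rewrite (free_actionEw _ (msuppZ_le _ _)) scaler_sumr; apply: eq_bigr => w _.
by rewrite mcoeffZ scalerA.
Qed.

Lemma free_actionM f g m : free_action (f * g) m = free_action f (free_action g m).
Proof.
rewrite malgME free_action_sum; apply: eq_bigr => v _.
rewrite free_action_sum.
have lin a n n' := word_action_linear v a n n'.
have -> : word_action v (free_action g m)
  = \sum_(w <- msupp g) g@_w *: word_action v (word_action w m).
  rewrite /free_action; elim/big_rec2: _ => [|w x y _ <-]; last exact: lin.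
  by have := lin (-1) 0 0; rewrite scaler0 addr0 scaleN1r addNr.
rewrite scaler_sumr; apply: eq_bigr => w _.
by rewrite free_actionU word_actionM scalerA.
Qed.

Lemma free_action_ideal (X : free_algebra k I -> Prop) :
    (forall f, X f -> forall m, free_action f m = 0) ->
  forall f, in_ideal X f -> forall m, free_action f m = 0.
Proof.
move=> X0 f; elim=> [g /X0 //|m|g1 g2 _ IH1 _ IH2 m|g1 g g2 _ IH m].
- exact: free_action0l.
- by rewrite free_actionD IH1 IH2 addr0.
- by rewrite !free_actionM IH free_action0r.
Qed.

End FreeAlgebraAction.

(* A_h = k<x,y>/(yx - xy - h(x)); the letters are x = false and y = true. *)
Section Ah.
Variables (k : fieldType) (h : {poly k}).

Let x : free_algebra k bool := free_algebra_gen k false.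
Let y : free_algebra k bool := free_algebra_gen k true.

Definition Ah_rel (r : free_algebra k bool) : Prop :=
  r = y * x - x * y - horner_alg x h.

Definition Ah := ideal_quotient Ah_rel.
HB.instance Definition _ := GRing.Lmodule.on Ah.
HB.instance Definition _ := GRing.PzRing.on Ah.

(* A_h is nonzero since it acts on k[x], with x acting by multiplication and y
   by the derivation h d/dx. *)
Let rho (b : bool) (p : {poly k}) := if b then h * p^`() else 'X * p.

Fact rho_linear b : linear (rho b).
Proof.
by case: b => a p q; rewrite /rho ?derivD ?derivZ mulrDr scalerAr.
Qed.

Fact horner_action (e : free_algebra k bool) (q : {poly k}) p :
  (forall p, free_action rho e p = 'X * p) ->
  free_action rho (horner_alg e q) p = q * p.
Proof.
move=> Ee; elim/poly_ind: q p => [|q c IH] p.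
  by rewrite rmorph0 mul0r free_action0l.
rewrite rmorphD rmorphM /= horner_algX horner_algC.
rewrite free_actionD (free_actionM rho_linear) Ee IH.
by rewrite free_actionZ free_action1 mulrDl mul_polyC mulrA.
Qed.

Fact relation_action (e f g : free_algebra k bool) p :
  (forall p, free_action rho e p = 'X * p) ->
  (forall p, free_action rho f p = h * p^`()) ->
  (forall p, free_action rho g p = h * p) ->
  free_action rho (f * e - e * f - g) p = 0.
Proof.
move=> Ee Ef Eg.
have := free_actionM rho_linear f e p; have := free_actionM rho_linear e f p.
move: (f * e) (e * f) => u v Ev Eu.
rewrite (free_actionB rho p (u - v) g) (free_actionB rho p u v) Eu Ev Ee Ef Ee Ef Eg.
rewrite derivM derivX mul1r mulrDr (mulrCA h 'X) addrK.
exact: subrr.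
Qed.

Fact Ah_rel_action f : Ah_rel f -> forall p, free_action rho f p = 0.
Proof.
move=> -> p; apply: relation_action => q.
- exact: free_action_gen.
- exact: free_action_gen.
by apply: horner_action => ?; exact: free_action_gen.
Qed.

Fact Ah_oner_neq0 : (1 : Ah) != 0.
Proof.
apply/eqP; rewrite -[0](raddf0 (ideal_class Ah_rel)) => /ideal_classP.
rewrite subr0 => /(free_action_ideal rho_linear Ah_rel_action) /(_ 1) /eqP.
by rewrite free_action1 oner_eq0.
Qed.

HB.instance Definition _ := GRing.PzSemiRing_isNonZero.Build Ah Ah_oner_neq0.
HB.instance Definition _ := GRing.Lmodule_isLalgebra.Build k Ah (@idealq_scalerAl _ _ _).
HB.instance Definition _ := GRing.Lalgebra_isAlgebra.Build k Ah (@idealq_scalerAr _ _ _).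
End Ah.

Section Tensor.
Variables (k : comPzRingType) (U V : lmodType k).

Let gen (u : U) (v : V) : free_module k (U * V)%type := free_gen k (u, v).

Inductive tensor_rel : free_module k (U * V)%type -> Prop :=
| TensorRelL a u u' v :
    tensor_rel (gen (a *: u + u') v - (a *: gen u v + gen u' v))
| TensorRelR a u v v' :
    tensor_rel (gen u (a *: v + v') - (a *: gen u v + gen u v')).

Definition tensor := quotient_module (span_submodule tensor_rel).
HB.instance Definition _ := GRing.Lmodule.on tensor.

Definition tens (u : U) (v : V) : tensor := quot_class (span_submodule tensor_rel) (gen u v).

Lemma tens_linear_l v : linear (tens^~ v).
Proof.
move=> a u u'; rewrite /tens -linearP; apply/quot_classP.
exact/SpanGen/TensorRelL.
Qed.

Lemma tens_linear_r u : linear (tens u).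
Proof.
move=> a v v'; rewrite /tens -linearP; apply/quot_classP.
exact/SpanGen/TensorRelR.
Qed.

Lemma tensor_ind (P : tensor -> Prop) :
    P 0 -> (forall a s t, P s -> P t -> P (a *: s + t)) ->
  (forall u v, P (tens u v)) -> forall t, P t.
Proof.
move=> P0 Plin Pgen t; have [g ->] := quot_class_surj t.
rewrite [g]free_moduleE raddf_sum /=.
elim/big_rec: _ => // [[u v]] s _ Ps; rewrite linearZ; apply: Plin => //.
exact: Pgen.
Qed.

Lemma tensor_ext (W : lmodType k) (f g : tensor -> W) :
  linear f -> linear g -> (forall u v, f (tens u v) = g (tens u v)) -> f =1 g.
Proof.
move=> fL gL fg.
have lin0 (e : tensor -> W) : linear e -> e 0 = 0.
  by move=> /(_ (-1) 0 0); rewrite scaler0 addr0 scaleN1r addNr.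
elim/tensor_ind => [|a s t fs ft|//]; first by rewrite !lin0.
by rewrite fL gL fs ft.
Qed.

Section Lift.
Variables (W : lmodType k) (f : U -> V -> W).
Hypothesis f_linear_l : forall v, linear (f^~ v).
Hypothesis f_linear_r : forall u, linear (f u).

Definition tensor_lift : tensor -> W :=
  quot_lift (free_lift (fun p : U * V => f p.1 p.2)).

Let wd g g' : span_submodule tensor_rel (g - g') ->
  free_lift (fun p : U * V => f p.1 p.2) g
  = free_lift (fun p : U * V => f p.1 p.2) g'.
Proof.
move=> gg'; apply/eqP; rewrite -subr_eq0 -raddfB; apply/eqP.
elim: gg' => [_ []|| a s t _ IHs _ IHt].
- move=> a u u' v; rewrite raddfB /= free_lift_is_linear !free_lift_gen /=.
  by rewrite f_linear_l subrr.
- move=> a u v v'; rewrite raddfB /= free_lift_is_linear !free_lift_gen /=.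
  by rewrite f_linear_r subrr.
- exact: raddf0.
- by rewrite /= free_lift_is_linear IHs IHt scaler0 addr0.
Qed.

Lemma tensor_liftE u v : tensor_lift (tens u v) = f u v.
Proof. by rewrite /tensor_lift quot_liftE ?free_lift_gen. Qed.

Lemma tensor_lift_linear : linear tensor_lift.
Proof.
move=> a s t; have [x ->] := quot_class_surj s; have [y ->] := quot_class_surj t.
by rewrite -linearP /tensor_lift !quot_liftE // linearP.
Qed.
End Lift.

End Tensor.

Section TensorRing.
Variables (k : comPzRingType) (A B : algType k).
Local Notation T := (tensor A B).

Let lmul (a : A) (b : B) : T -> T := tensor_lift (fun c d => tens (a * c) (b * d)).

Let lmul_wd_l (a : A) (b : B) d : linear ((fun c d => tens (a * c) (b * d))^~ d).
Proof. by move=> s c c'; rewrite mulrDr -scalerAr tens_linear_l. Qed.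

Let lmul_wd_r (a : A) (b : B) c : linear ((fun c d => tens (a * c) (b * d)) c).
Proof. by move=> s d d'; rewrite mulrDr -scalerAr tens_linear_r. Qed.

Let lmulE a b c d : lmul a b (tens c d) = tens (a * c) (b * d).
Proof. by rewrite /lmul tensor_liftE. Qed.

Let lmul_linear a b : linear (lmul a b).
Proof. by apply: tensor_lift_linear; [exact: lmul_wd_l|exact: lmul_wd_r]. Qed.

Let comb_linear (f g : T -> T) (s : k) :
  linear f -> linear g -> linear (fun t => s *: f t + g t).
Proof.
move=> fL gL a t u; rewrite fL gL scalerDr scalerDr !scalerA (mulrC s a).
exact: addrACA.
Qed.

Let lmul_linear_l b : linear (lmul^~ b).
Proof.
move=> s a a'; apply/funext; apply: tensor_ext.
- exact: lmul_linear.
- by apply: comb_linear; exact: lmul_linear.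
- move=> c d; rewrite -[RHS]/(s *: lmul a b (tens c d) + lmul a' b (tens c d)) !lmulE.
  by rewrite mulrDl -scalerAl tens_linear_l.
Qed.

Let lmul_linear_r a : linear (lmul a).
Proof.
move=> s b b'; apply/funext; apply: tensor_ext.
- exact: lmul_linear.
- by apply: comb_linear; exact: lmul_linear.
- move=> c d; rewrite -[RHS]/(s *: lmul a b (tens c d) + lmul a b' (tens c d)) !lmulE.
  by rewrite mulrDl -scalerAl tens_linear_r.
Qed.

Definition tensor_mul (s t : T) : T := tensor_lift lmul s t.

Lemma tensor_mul_linear_l t : linear (tensor_mul^~ t).
Proof.
by move=> a s s'; rewrite /tensor_mul (tensor_lift_linear lmul_linear_l lmul_linear_r).
Qed.

Lemma tensor_mul_linear_r s : linear (tensor_mul s).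
Proof.
elim/tensor_ind: s => [|a s s' IHs IHs'|u v] b t t'.
- have E x : tensor_mul 0 x = 0.
    by have := tensor_mul_linear_l x (-1) 0 0; rewrite scaler0 addr0 scaleN1r addNr.
  by rewrite !E scaler0 addr0.
- by rewrite !tensor_mul_linear_l; exact: comb_linear.
- by rewrite /tensor_mul !tensor_liftE // lmul_linear.
Qed.

Lemma tensor_mulE a b c d :
  tensor_mul (tens a b) (tens c d) = tens (a * c) (b * d).
Proof. by rewrite /tensor_mul tensor_liftE // lmulE. Qed.

Lemma tensor_mulZl c s t : tensor_mul (c *: s) t = c *: tensor_mul s t.
Proof.
have E x : tensor_mul 0 x = 0.
  by have := tensor_mul_linear_l x (-1) 0 0; rewrite scaler0 addr0 scaleN1r addNr.
by rewrite -[c *: s]addr0 tensor_mul_linear_l E addr0.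
Qed.

Lemma tensor_mulZr c s t : tensor_mul s (c *: t) = c *: tensor_mul s t.
Proof.
have E x : tensor_mul x 0 = 0.
  by have := tensor_mul_linear_r x (-1) 0 0; rewrite scaler0 addr0 scaleN1r addNr.
by rewrite -[c *: t]addr0 tensor_mul_linear_r E addr0.
Qed.

Fact tensor_mulA : associative tensor_mul.
Proof.
move=> s t u; have L := tensor_mul_linear_l; have R := tensor_mul_linear_r.
apply: (@tensor_ext _ _ _ _ (fun s => tensor_mul s (tensor_mul t u))
  (fun s => tensor_mul (tensor_mul s t) u)) s => [||a b].
- by move=> a s s' /=; rewrite L.
- by move=> a s s' /=; rewrite !L.
apply: (@tensor_ext _ _ _ _ (fun t => tensor_mul (tens a b) (tensor_mul t u))
  (fun t => tensor_mul (tensor_mul (tens a b) t) u)) t => [||c d].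
- by move=> r s s' /=; rewrite L R.
- by move=> r s s' /=; rewrite R L.
apply: (@tensor_ext _ _ _ _ (fun u => tensor_mul (tens a b) (tensor_mul (tens c d) u))
  (fun u => tensor_mul (tensor_mul (tens a b) (tens c d)) u)) u => [||e f].
- by move=> r s s' /=; rewrite !R.
- by move=> r s s' /=; rewrite !R.
by rewrite !tensor_mulE !mulrA.
Qed.

Fact tensor_mul1l : left_id (tens 1 1) tensor_mul.
Proof.
apply: tensor_ext => [||a b]; [exact: tensor_mul_linear_r|by []|].
by rewrite tensor_mulE !mul1r.
Qed.

Fact tensor_mul1r : right_id (tens 1 1) tensor_mul.
Proof.
apply: tensor_ext => [||a b]; [exact: tensor_mul_linear_l|by []|].
by rewrite tensor_mulE !mulr1.
Qed.

Fact tensor_mulDl : left_distributive tensor_mul +%R.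
Proof.
move=> s t u; have := tensor_mul_linear_l u 1 s t.
by rewrite !scale1r.
Qed.

Fact tensor_mulDr : right_distributive tensor_mul +%R.
Proof.
move=> s t u; have := tensor_mul_linear_r s 1 t u.
by rewrite !scale1r.
Qed.

HB.instance Definition _ := GRing.Zmodule_isPzRing.Build T
  tensor_mulA tensor_mul1l tensor_mul1r tensor_mulDl tensor_mulDr.

Lemma tensM a b c d : (tens a b : T) * tens c d = tens (a * c) (b * d).
Proof. exact: tensor_mulE. Qed.

Lemma tens11 : (tens 1 1 : T) = 1. Proof. by []. Qed.

Fact tensor_scalerAl (c : k) (s t : T) : c *: (s * t) = (c *: s) * t.
Proof. exact/esym/tensor_mulZl. Qed.

Fact tensor_scalerAr (c : k) (s t : T) : c *: (s * t) = s * (c *: t).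
Proof. exact/esym/tensor_mulZr. Qed.

End TensorRing.

Section ConverseAlgebra.
Variables (k : comPzRingType) (A : algType k).

HB.instance Definition _ := GRing.Lmodule.copy A^c A.

Fact converse_scalerAl (c : k) (a b : A^c) :
  c *: (a * b) = (c *: a : A^c) * b :> A^c.
Proof. exact: (scalerAr c (b : A) (a : A)). Qed.

Fact converse_scalerAr (c : k) (a b : A^c) : c *: (a * b) = a * (c *: b).
Proof. exact: (scalerAl c (b : A) (a : A)). Qed.

HB.instance Definition _ := GRing.Lmodule_isLalgebra.Build k A^c converse_scalerAl.
HB.instance Definition _ := GRing.Lalgebra_isAlgebra.Build k A^c converse_scalerAr.

End ConverseAlgebra.

(* A^e = A (x) A^op, acting on A by (a (x) b) . m = a m b. *)
Section Enveloping.
Variables (k : comPzRingType) (A : algType k).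

Definition enveloping := tensor A A^c.
HB.instance Definition _ := GRing.Lmodule.on enveloping.
HB.instance Definition _ := GRing.PzRing.on enveloping.

Definition bimod_action (s : enveloping) (m : A) : A :=
  tensor_lift (fun (a : A) (b : A^c) => ((fun m : A => a * m * (b : A)) : A -> A)) s m.

Let wd_l (b : A^c) : linear ((fun (a : A) (b : A^c) =>
  ((fun m : A => a * m * (b : A)) : A -> A))^~ b).
Proof. by move=> c a a'; apply/funext => m /=; rewrite !mulrDl -!scalerAl. Qed.

Let wd_r (a : A) : linear ((fun (a : A) (b : A^c) =>
  ((fun m : A => a * m * (b : A)) : A -> A)) a).
Proof. by move=> c b b'; apply/funext => m /=; rewrite mulrDr -scalerAr. Qed.

Lemma bimod_actionE (a : A) (b : A^c) (m : A) :
  bimod_action (tens a b) m = a * m * (b : A).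
Proof. by rewrite /bimod_action (tensor_liftE wd_l wd_r). Qed.

Lemma bimod_action_linear_l m : linear (bimod_action^~ m).
Proof. by move=> c s t; rewrite /bimod_action (tensor_lift_linear wd_l wd_r). Qed.

Fact bimod_action1 : left_id 1 bimod_action.
Proof. by move=> m; rewrite -tens11 bimod_actionE mulr1 mul1r. Qed.

Fact enveloping_oner_neq0 : (1 : enveloping) != 0.
Proof.
apply/eqP => /(congr1 (bimod_action^~ 1)); rewrite bimod_action1 => E.
have := bimod_action_linear_l 1 (-1) 0 0; rewrite scaler0 addr0 scaleN1r addNr.
by rewrite -E => /eqP; rewrite oner_eq0.
Qed.

HB.instance Definition _ :=
  GRing.PzSemiRing_isNonZero.Build enveloping enveloping_oner_neq0.
HB.instance Definition _ := GRing.Lmodule_isLalgebra.Build k enveloping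
  (@tensor_scalerAl _ _ _).
HB.instance Definition _ := GRing.Lalgebra_isAlgebra.Build k enveloping
  (@tensor_scalerAr _ _ _).

Definition regular_bimodule : Type := A.
HB.instance Definition _ := GRing.Zmodule.on regular_bimodule.

Lemma bimod_action_linear_r s : linear (bimod_action s).
Proof.
have L := bimod_action_linear_l.
elim/tensor_ind: s => [|a s s' IHs IHs'|u v] b m n.
- have E x : bimod_action 0 x = 0.
    by have := L x (-1) 0 0; rewrite scaler0 addr0 scaleN1r addNr.
  by rewrite !E scaler0 addr0.
- rewrite !L IHs IHs' !scalerDr !scalerA (mulrC b a).
  exact: addrACA.
- by rewrite !bimod_actionE mulrDr mulrDl -scalerAr -scalerAl.
Qed.

Fact bimod_actionDr : right_distributive bimod_action +%R.
Proof. by move=> s m n; have := bimod_action_linear_r s 1 m n; rewrite !scale1r. Qed.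

Fact bimod_actionDl m : {morph bimod_action^~ m : s t / s + t}.
Proof.
by move=> s t /=; have := bimod_action_linear_l m 1 s t; rewrite !scale1r.
Qed.

Fact bimod_actionA s t m :
  bimod_action s (bimod_action t m) = bimod_action (s * t) m.
Proof.
have L := bimod_action_linear_l; have R := bimod_action_linear_r.
apply: (@tensor_ext _ _ _ _ (fun s => bimod_action s (bimod_action t m))
  (fun s => bimod_action (tensor_mul s t) m)) s => [||a b].
- by move=> c s s' /=; rewrite L.
- by move=> c s s' /=; rewrite tensor_mul_linear_l L.
apply: (@tensor_ext _ _ _ _ (fun t => bimod_action (tens a b) (bimod_action t m))
  (fun t => bimod_action (tensor_mul (tens a b) t) m)) t => [||c d].
- by move=> r s s' /=; rewrite L R.
- by move=> r s s' /=; rewrite tensor_mul_linear_r L.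
by rewrite tensor_mulE !bimod_actionE -[b * d]/((d : A) * (b : A)) !mulrA.
Qed.

HB.instance Definition _ := GRing.Zmodule_isLmodule.Build enveloping regular_bimodule
  bimod_actionA bimod_action1 bimod_actionDr bimod_actionDl.

End Enveloping.

Definition projective (R : pzRingType) (P : lmodType R) : Prop :=
  forall (V W : lmodType R) (g : {linear V -> W}) (f : {linear P -> W}),
    (forall w, exists v, g v = w) ->
  exists f' : {linear P -> V}, forall p, g (f' p) = f p.

(* ... -> P_2 -> P_1 -> P_0 -> M -> 0 *)
Record projective_resolution (R : pzRingType) (M : lmodType R) := {
  res_obj :> nat -> lmodType R;
  res_diff : forall n, {linear res_obj n.+1 -> res_obj n};
  res_aug : {linear res_obj 0 -> M};
  res_projective : forall n, projective (res_obj n);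
  res_aug_surj : forall m, exists p, res_aug p = m;
  res_aug_exact : forall p, res_aug p = 0 <-> exists q, res_diff 0 q = p;
  res_diff_exact : forall n p,
    res_diff n p = 0 <-> exists q, res_diff n.+1 q = p }.

(* The free resolution of M in which each P_n is free on the underlying set of
   the n-th syzygy module. *)
Section FreeResolution.
Variable R : pzRingType.

Lemma free_module_projective (T : choiceType) : projective (free_module R T).
Proof.
move=> V W g f gsurj; have [c cP] := choice (fun t => gsurj (f (free_gen R t))).
exists (free_lift c) => p; rewrite [in RHS](free_moduleE p) raddf_sum.
rewrite /= /free_lift raddf_sum; apply: eq_bigr => t _.
by rewrite linearZ [g _]cP -linearZ.
Qed.

Variable M : lmodType R.

Fixpoint syzygy (n : nat) : lmodType R :=
  if n is m.+1 then
    submodule_type (ker_submodule (free_lift (id : syzygy m -> syzygy m)))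
  else M.

Definition free_res_aug (n : nat) : {linear free_module R (syzygy n) -> syzygy n} :=
  free_lift (id : syzygy n -> syzygy n).

Definition free_res_diff (n : nat) (f : free_module R (syzygy n.+1)) :
  free_module R (syzygy n) := val (free_res_aug n.+1 f).

Fact free_res_diff_is_linear n : linear (@free_res_diff n).
Proof. by move=> a f g; rewrite /free_res_diff (linearP (free_res_aug n.+1)). Qed.
HB.instance Definition _ n := GRing.isLinear.Build R _ _ *:%R
  (@free_res_diff n) (@free_res_diff_is_linear n).

Lemma free_res_aug_surj n m : exists p, free_res_aug n p = m.
Proof. by exists (free_gen R m); exact: free_lift_gen. Qed.

Lemma free_res_exact n (p : free_module R (syzygy n)) :
  free_res_aug n p = 0 <-> exists q, free_res_diff q = p.
Proof.
split=> [p0|[q <-]]; last exact: (submodule_valP (free_res_aug n.+1 q)).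
have [q Eq] := free_res_aug_surj (n := n.+1)
  (in_sub (U := ker_submodule (free_res_aug n)) p0).
by exists q; rewrite /free_res_diff Eq.
Qed.

Lemma free_res_diff_exact n (p : free_module R (syzygy n.+1)) :
  free_res_diff p = 0 <-> exists q, free_res_diff q = p.
Proof.
apply: iff_trans (free_res_exact p); rewrite /free_res_diff.
by split=> [p0|->]; [exact: val_inj|].
Qed.

Definition free_resolution : projective_resolution M :=
  @Build_projective_resolution R M
    (fun n => free_module R (syzygy n))
    (fun n => @free_res_diff n) (free_res_aug 0)
    (fun n => @free_module_projective (syzygy n))
    (@free_res_aug_surj 0) (@free_res_exact 0) free_res_diff_exact.

End FreeResolution.

Section RestrictScalars.
Variables (k : pzRingType) (R : algType k) (N : lmodType R).

(* N as a k-module through k -> R; the library keeps scalings by different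
   rings apart only on types with different names. *)
Definition restrict_scalars : Type := N.
HB.instance Definition _ := GRing.Zmodule.on restrict_scalars.

Definition restrict_scale (c : k) (n : restrict_scalars) : restrict_scalars :=
  (c%:A : R) *: (n : N).

Fact restrict_scaleA a b n :
  restrict_scale a (restrict_scale b n) = restrict_scale (a * b) n.
Proof. by rewrite /restrict_scale scalerA -scalerAl mul1r scalerA. Qed.

Fact restrict_scale1 : left_id 1 restrict_scale.
Proof. by move=> n; rewrite /restrict_scale !scale1r. Qed.

Fact restrict_scaleDr : right_distributive restrict_scale +%R.
Proof. by move=> a m n; rewrite /restrict_scale scalerDr. Qed.

Fact restrict_scaleDl n : {morph restrict_scale^~ n : a b / a + b}.
Proof. by move=> a b; rewrite /restrict_scale !scalerDl. Qed.

HB.instance Definition _ := GRing.Zmodule_isLmodule.Build k restrict_scalars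
  restrict_scaleA restrict_scale1 restrict_scaleDr restrict_scaleDl.

End RestrictScalars.

Section Hom.
Variables (k : pzRingType) (R : algType k) (P N : lmodType R).

Definition is_hom (f : P -> restrict_scalars N) : Prop := linear (f : P -> N).

Fact is_hom0 : is_hom 0.
Proof. by move=> a p q; rewrite scaler0 addr0. Qed.

Fact is_homP (c : k) f g : is_hom f -> is_hom g -> is_hom (c *: f + g).
Proof.
move=> fL gL a p q.
rewrite -[LHS]/((c%:A : R) *: (f (a *: p + q) : N) + (g (a *: p + q) : N)).
rewrite -[RHS]/(a *: ((c%:A : R) *: (f p : N) + (g p : N)) +
  ((c%:A : R) *: (f q : N) + (g q : N))).
rewrite fL gL !scalerDr !scalerA -scalerAl mul1r -scalerAr mulr1.
exact: addrACA.
Qed.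

Definition hom_submodule : submodule (P -> restrict_scalars N) :=
  Submodule is_hom0 is_homP.

Definition Hom : lmodType k := submodule_type hom_submodule.

End Hom.

Section HomMap.
Variables (k : pzRingType) (R : algType k) (P Q N : lmodType R).
Variable d : {linear Q -> P}.

Fact hom_map_is_hom (f : Hom P N) : is_hom (fun q => val f (d q)).
Proof. by move=> a p q; rewrite linearP (submodule_valP f). Qed.

Definition hom_map (f : Hom P N) : Hom Q N :=
  in_sub (U := hom_submodule Q N) (hom_map_is_hom f).

Fact hom_map_is_linear : linear hom_map.
Proof. by move=> c f g; apply: val_inj. Qed.

HB.instance Definition _ :=
  GRing.isLinear.Build k (Hom P N) (Hom Q N) *:%R hom_map hom_map_is_linear.

End HomMap.

Section Cohomology.
Variables (k : pzRingType) (C : nat -> lmodType k).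
Variable delta : forall n, {linear C n -> C n.+1}.

Definition cocycle (n : nat) : lmodType k := submodule_type (ker_submodule (delta n)).

Definition is_coboundary (n : nat) : C n -> Prop :=
  match n return C n -> Prop with
  | 0 => fun z => z = 0
  | m.+1 => fun z => exists f, delta m f = z
  end.

Fact is_coboundary0 n : is_coboundary (0 : C n).
Proof. by case: n => //= n; exact: im_submodule0. Qed.

Fact is_coboundaryP n (a : k) (u v : C n) :
  is_coboundary u -> is_coboundary v -> is_coboundary (a *: u + v).
Proof. by case: n u v => [|n] u v; [exact: zero_submoduleP|exact: im_submoduleP]. Qed.

Definition coboundary (n : nat) : submodule (cocycle n) :=
  @Submodule _ (cocycle n) (fun z => is_coboundary (val z))
    (is_coboundary0 n) (fun a u v => @is_coboundaryP n a (val u) (val v)).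

Definition cohomology (n : nat) : lmodType k := quotient_module (coboundary n).

End Cohomology.

Definition Ext_of (k : pzRingType) (R : algType k) (M N : lmodType R)
    (P : projective_resolution M) (n : nat) : lmodType k :=
  cohomology (fun i => hom_map (N := N) (res_diff P i)) n.

(* By the comparison theorem, Ext_of does not depend, up to isomorphism, on the
   projective resolution. *)
Definition Ext (k : pzRingType) (R : algType k) (n : nat) (M N : lmodType R) :
  lmodType k := Ext_of N (free_resolution M) n.

Definition HH (k : comPzRingType) (n : nat) (A : algType k) : lmodType k :=
  Ext n (regular_bimodule A) (regular_bimodule A).

Definition poly_quotient (k : fieldType) (p : {poly k}) : lmodType k :=
  ideal_quotient (fun r : {poly k} => r = p).

Definition poly_quotient_ideal (k : fieldType) (p q : {poly k}) : lmodType k :=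
  let Sp := ideal_quotient (fun r : {poly k} => r = p) in
  submodule_type (ideal_of_quotient
    (fun a : Sp => a = ideal_class (fun r : {poly k} => r = p) q)).

(* W[y]; here W is only a vector space, so {poly W} is not available. *)
Definition polys_in_y (k : fieldType) (W : lmodType k) : lmodType k :=
  fsupp nat W.

(* Main.v *)
(**
Write [U = x (x) 1 - 1 (x) x] and [V = y (x) 1 - 1 (x) y] in [A^e]. The
commutator relation becomes [W U = U V] with [W = V - Delta], where
[Delta U = h (x) 1 - 1 (x) h], so that
[0 -> A^e -> A^e^2 -> A^e -> A -> 0], with [1 |-> (W, -U)] and
[(a, b) |-> a U + b V], is a free resolution of [A]: its exactness reduces to
the right regularity of [U] and to that of [V] modulo [A^e U], both read off the
basis [x^i y^j] of [A]. The comparison theorem then identifies [HH] with the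
cohomology of [A -> A^2 -> A], [a |-> ([x,a], [y,a])],
[(u, v) |-> W u - [x,v]].

In characteristic zero the image of [[x, -]] is [h A] and its kernel is [S],
while [[y, -]] is [h d/dx] on coefficients, and [W] acts as [- h'] modulo [h A].
Hence [HH^2 = A/(h A + h' A) = A/d A], and in degree one a cocycle [(u, v)]
exists over [u] exactly when [h] divides [h' u], that is when [h/d] divides [u];
the map sending [(u, v)] to the class modulo [h] of the coefficient of [y^0]
in [v] and to the classes modulo [h] of the coefficients of [u] has the
coboundaries as kernel.
*)
From HB Require Import structures.
From mathcomp Require Import all_boot all_algebra.
From mathcomp Require Import finmap boolp.
From mathcomp Require Import ring.
From mathcomp.multinomials Require Import monalg.
Require Import Defs.

Set Implicit Arguments.
Unset Strict Implicit.
Unset Printing Implicit Defensive.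

Import GRing.Theory.
Local Open Scope ring_scope.

Definition linear_of (R : pzRingType) (V W : lmodType R) (f : V -> W)
    (fL : linear f) : {linear V -> W} :=
  HB.pack f (GRing.isLinear.Build R V W *:%R f fL).

(** * Comparison of projective resolutions *)

Section LinearIsomorphisms.
Variables (R : pzRingType).

Lemma lin_iso_trans (V1 V2 V3 : lmodType R) :
  lin_iso V1 V2 -> lin_iso V2 V3 -> lin_iso V1 V3.
Proof.
move=> [f fB] [g gB].
by exists ((g : {linear _ -> _}) \o (f : {linear _ -> _})); exact: bij_comp.
Qed.

Lemma bij_of_inj_surj (S T : Type) (f : S -> T) :
  injective f -> (forall y, exists x, f x = y) -> bijective f.
Proof.
move=> f_inj /choice[g fgK]; exists g => // x.
by apply: f_inj; rewrite fgK.
Qed.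

(** First isomorphism theorem. Every isomorphism below is obtained by giving a linear map on
    cocycles that is onto and has the coboundaries as kernel. *)
Lemma quotient_lin_iso (V W : lmodType R) (U : submodule V) (g : {linear V -> W}) :
    (forall w, exists v, g v = w) -> (forall v, g v = 0 <-> U v) ->
  lin_iso (quotient_module U) W.
Proof.
move=> g_surj g_ker.
have gE x : quot_lift g (quot_class U x) = g x.
  apply: quot_liftE => {}x y /g_ker; rewrite raddfB => /eqP.
  by rewrite subr_eq0 => /eqP.
have qL : linear (quot_lift g : quotient_module U -> W).
  move=> a p q; have [x ->] := quot_class_surj p.
  have [y ->] := quot_class_surj q.
  by rewrite -linearP !gE linearP.
exists (linear_of qL); apply: bij_of_inj_surj => [p q|w] /=; last first.
  by have [v <-] := g_surj w; exists (quot_class U v); exact: gE.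
have [x ->] := quot_class_surj p; have [y ->] := quot_class_surj q.
rewrite !gE => gxy; apply/quot_classP/g_ker.
by apply/eqP; rewrite linearB subr_eq0 gxy.
Qed.

End LinearIsomorphisms.

(** Builds chain maps degree by degree: the type of the choice varies with the degree and each
    choice depends on the preceding one. *)
Lemma dependent_choice_seq (T : nat -> Type) (r : forall n, T n -> T n.+1 -> Prop) :
    (forall n (x : T n), exists y, r n x y) -> forall x0 : T 0,
  exists f : forall n, T n, f 0 = x0 /\ forall n, r n (f n) (f n.+1).
Proof.
move=> step x0.
pose next n (x : T n) : {y | r n x y} := cid (step n x).
pose f := fix f n : T n := if n is m.+1 then sval (next m (f m)) else x0.
by exists f; split=> // n; exact: (svalP (next n (f n))).
Qed.

Section Comparison.
Variable R : pzRingType.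

(** By exactness [d1] is onto the kernel of [d0], and [f] takes its values there, so projectivity
    applies after corestricting both maps to this kernel. *)
Lemma projective_lift (P A B C : lmodType R) (d1 : {linear A -> B})
    (d0 : {linear B -> C}) (f : {linear P -> B}) :
    projective P -> (forall b, d0 b = 0 <-> exists a, d1 a = b) ->
    (forall p, d0 (f p) = 0) ->
  exists g : {linear P -> A}, forall p, d1 (g p) = f p.
Proof.
move=> P_proj ex df0.
pose K := ker_submodule d0.
have d1K a : K (d1 a) by apply/ex; exists a.
pose e a : submodule_type K := in_sub (d1K a).
pose f1 p : submodule_type K := in_sub (U := K) (df0 p).
have eL : linear e by move=> c u v; apply: val_inj; rewrite /= linearP.
have f1L : linear f1 by move=> c u v; apply: val_inj; rewrite /= linearP.
have [|g gP] := P_proj _ _ (linear_of eL) (linear_of f1L).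
  move=> w; have [a da] := (ex (val w)).1 (submodule_valP w).
  by exists a; apply: val_inj.
by exists g => p; have /(congr1 val) := gP p.
Qed.

Variable M : lmodType R.
Implicit Types P Q : projective_resolution M.

Definition chain_map P Q (F : forall n, {linear P n -> Q n}) :=
  forall n p, res_diff Q n (F n.+1 p) = F n (res_diff P n p).

Lemma res_augd P p : res_aug P (res_diff P 0 p) = 0.
Proof. by apply/res_aug_exact; exists p. Qed.

Lemma res_diffd P n p : res_diff P n (res_diff P n.+1 p) = 0.
Proof. by apply/res_diff_exact; exists p. Qed.

Lemma chain_map_exists P Q :
  exists F : forall n, {linear P n -> Q n},
    chain_map F /\ forall p, res_aug Q (F 0 p) = res_aug P p.
Proof.
(* This is the condition under which the next component can be constructed; the recursion carries it
   along in the subset type [T]. *)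
pose good n (f : {linear P n -> Q n}) :=
  forall p, exists q, res_diff Q n q = f (res_diff P n p).
have [f0 f0P] : exists f : {linear P 0 -> Q 0}, forall p, res_aug Q (f p) = res_aug P p.
  exact: (@res_projective _ _ P 0 _ _ (res_aug Q) (res_aug P) (@res_aug_surj _ _ Q)).
have f0_good : good 0 f0.
  by move=> p; apply/res_aug_exact; rewrite f0P res_augd.
pose T n := {f : {linear P n -> Q n} | good n f}.
pose r n (f : T n) (g : T n.+1) :=
  forall p, res_diff Q n (sval g p) = sval f (res_diff P n p).
have step n (f : T n) : exists g, r n f g.
  case: f => f fP.
  have [g gP] : exists g : {linear P n.+1 -> Q n.+1}, forall p,
      res_diff Q n (g p) = f (res_diff P n p).
    case: n f fP => [|n] f fP.
      apply: (projective_lift (d1 := res_diff Q 0) (f := f \o res_diff P 0)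
        (@res_projective _ _ P 1) (@res_aug_exact _ _ Q)).
      by move=> p; apply/res_aug_exact/fP.
    apply: (projective_lift (d1 := res_diff Q n.+1)
      (f := f \o res_diff P n.+1) (@res_projective _ _ P n.+2) (@res_diff_exact _ _ Q n)).
    by move=> p; apply/res_diff_exact/fP.
  have g_good : good n.+1 g.
    by move=> p; apply/res_diff_exact; rewrite gP res_diffd raddf0.
  by exists (exist _ g g_good).
have [F [F0 FP]] := dependent_choice_seq step (exist _ f0 f0_good).
by exists (fun n => sval (F n)); rewrite F0; split.
Qed.

(** The homotopy is given by two consecutive components in each degree, not as one sequence: a
    cocycle of degree [n.+1] sees only these two. *)
Lemma null_homotopy P Q (F : forall n, {linear P n -> Q n}) :
    chain_map F -> (forall p, res_aug Q (F 0 p) = 0) ->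
  exists s0 : {linear P 0 -> Q 1},
    (forall p, res_diff Q 0 (s0 p) = F 0 p) /\
  forall n, exists (s : {linear P n -> Q n.+1}) (s' : {linear P n.+1 -> Q n.+2}),
    forall p, F n.+1 p = res_diff Q n.+1 (s' p) + s (res_diff P n p).
Proof.
move=> F_chain F0.
have [s0 s0P] := projective_lift (@res_projective _ _ P 0) (@res_aug_exact _ _ Q) F0.
exists s0; split=> // n.
(* The identity is assumed on boundaries only. The new component satisfies it again, because the
   term in [s] dies on boundaries. *)
have lift_next m (s : {linear P m -> Q m.+1}) :
    (forall p, res_diff Q m (s (res_diff P m p)) = F m (res_diff P m p)) ->
    exists s' : {linear P m.+1 -> Q m.+2},
      forall p, F m.+1 p = res_diff Q m.+1 (s' p) + s (res_diff P m p).
  move=> sP; pose e p := F m.+1 p - s (res_diff P m p).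
  have eL : linear e.
    by move=> a p q; rewrite /e !linearP scalerDr addrACA.
  have [|s' s'P] := projective_lift (f := linear_of eL) (@res_projective _ _ P m.+1)
    (@res_diff_exact _ _ Q m).
    by move=> p; rewrite /= /e raddfB /= F_chain sP subrr.
  by exists s' => p; rewrite s'P /= /e subrK.
suff [s sP] : exists s : {linear P n -> Q n.+1},
    forall p, res_diff Q n (s (res_diff P n p)) = F n (res_diff P n p).
  by have [s' s'P] := lift_next _ _ sP; exists s, s'.
elim: n => [|n [s /lift_next[s' s'P]]]; first by exists s0.
by exists s' => p; rewrite s'P res_diffd raddf0 addr0.
Qed.

End Comparison.

Section ExtComparison.
Variables (k : pzRingType) (R : algType k) (M N : lmodType R).
Implicit Types P Q : projective_resolution M.

Lemma hom_mapE (P Q : lmodType R) (d : {linear Q -> P}) (f : Hom P N) q :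
  val (hom_map d f) q = val f (d q).
Proof. by []. Qed.

Lemma hom_linear (P : lmodType R) (f : Hom P N) : linear (val f : P -> N).
Proof. exact: (submodule_valP f). Qed.

Lemma homD (P : lmodType R) (f : Hom P N) p q : val f (p + q) = val f p + val f q.
Proof. by have := hom_linear f 1 p q; rewrite !scale1r. Qed.

Lemma hom0 (P : lmodType R) (f : Hom P N) : val f 0 = 0.
Proof. by apply: (addIr (val f 0)); rewrite -homD !add0r. Qed.

Lemma hom_eqP (P : lmodType R) (f g : Hom P N) : (forall p, val f p = val g p) -> f = g.
Proof. by move=> fg; apply/val_inj/funext. Qed.

Local Notation delta P := (fun i => hom_map (N := N) (res_diff P i)).

(** Composing a cocycle [z] with the homotopy formula kills the term ending in a differential and
    leaves the coboundary of [z] composed with [s]. *)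
Lemma null_homotopic_coboundary P Q (F : forall n, {linear P n -> Q n}) :
    chain_map F -> (forall p, res_aug Q (F 0 p) = 0) ->
  forall n (z : Hom (Q n) N), hom_map (res_diff Q n) z = 0 ->
  is_coboundary (delta P) (hom_map (F n) z).
Proof.
move=> F_chain F0 n z z0.
have zd q : val z (res_diff Q n q) = 0 by rewrite -hom_mapE z0.
have [s0 [s0P ht]] := null_homotopy F_chain F0.
case: n z z0 zd => [|n] z z0 zd /=.
  by apply: hom_eqP => p; rewrite hom_mapE -s0P zd.
have [s [s' ss']] := ht n; exists (hom_map s z); apply: hom_eqP => p.
by rewrite !hom_mapE ss' homD zd add0r.
Qed.

Lemma chain_map_coboundary P Q (F : forall n, {linear P n -> Q n}) :
    chain_map F -> forall n (z : Hom (Q n) N),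
  is_coboundary (delta Q) z -> is_coboundary (delta P) (hom_map (F n) z).
Proof.
move=> F_chain [|n] z /=; first by move=> ->; rewrite raddf0.
case=> f <-; exists (hom_map (F n) f); apply: hom_eqP => p.
by rewrite !hom_mapE F_chain.
Qed.

(* If [F] and [G] are chain maps in both directions, then [id - G F] is
   null-homotopic, so every cocycle is cohomologous to its pullback. *)
Lemma pullback_cohomologous P Q (F : forall n, {linear P n -> Q n})
    (G : forall n, {linear Q n -> P n}) :
    chain_map F -> (forall p, res_aug Q (F 0 p) = res_aug P p) ->
    chain_map G -> (forall q, res_aug P (G 0 q) = res_aug Q q) ->
  forall n (z : Hom (P n) N), hom_map (res_diff P n) z = 0 ->
  is_coboundary (delta P) (z - hom_map (F n) (hom_map (G n) z)).
Proof.
move=> F_chain F_aug G_chain G_aug n z z0.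
pose e m p := p - G m (F m p).
have eL m : linear (e m).
  by move=> a p q; rewrite /e !linearP scalerDr addrACA.
have e_chain : chain_map (fun m => linear_of (eL m)).
  by move=> m p; rewrite /= /e raddfB /= G_chain F_chain.
have e_aug p : res_aug P (linear_of (eL 0) p) = 0.
  by rewrite /= /e raddfB /= G_aug F_aug subrr.
have := null_homotopic_coboundary e_chain e_aug z0.
suff -> : hom_map (linear_of (eL n)) z = z - hom_map (F n) (hom_map (G n) z) by [].
apply: hom_eqP => p; rewrite hom_mapE /= /e.
rewrite -[RHS]/(val z p - val z (G n (F n p))).
by apply/eqP; rewrite eq_sym subr_eq -homD subrK.
Qed.

(** Pullbacks along chain maps in the two directions are mutually inverse up to coboundaries, which
    gives both surjectivity and the kernel. *)
Theorem Ext_of_resolution P Q n : lin_iso (Ext_of N P n) (Ext_of N Q n).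
Proof.
have [F [F_chain F_aug]] := chain_map_exists Q P.
have [G [G_chain G_aug]] := chain_map_exists P Q.
have FZ (z : cocycle (delta P) n) : hom_map (res_diff Q n) (hom_map (F n) (val z)) = 0.
  apply: hom_eqP => q; rewrite !hom_mapE -F_chain -hom_mapE.
  by rewrite (submodule_valP z).
pose f (z : cocycle (delta P) n) : cocycle (delta Q) n :=
  in_sub (U := ker_submodule (hom_map (res_diff Q n))) (FZ z).
have fL : linear f by move=> a u v; apply: val_inj; rewrite /= linearP.
pose g : {linear cocycle (delta P) n -> Ext_of N Q n} :=
  quot_class (coboundary (delta Q) n) \o linear_of fL.
apply: (@quotient_lin_iso _ _ _ _ g) => [w|z].
  have [z ->] := quot_class_surj w.
  have GZ : hom_map (res_diff P n) (hom_map (G n) (val z)) = 0.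
    apply: hom_eqP => q; rewrite !hom_mapE -G_chain -hom_mapE.
    by rewrite (submodule_valP z).
  exists (in_sub (U := ker_submodule (hom_map (res_diff P n))) GZ).
  apply/esym/quot_classP.
  exact: (pullback_cohomologous F_chain F_aug G_chain G_aug (submodule_valP z)).
have g0 : g z = 0 <-> is_coboundary (delta Q) (hom_map (F n) (val z)).
  rewrite -[0](raddf0 (quot_class (coboundary (delta Q) n))).
  by apply: iff_trans (quot_classP _ _ _) _; rewrite subr0.
apply: iff_trans g0 _; split; last exact: chain_map_coboundary.
move=> /(chain_map_coboundary G_chain) cob.
have := pullback_cohomologous G_chain G_aug F_chain F_aug (submodule_valP z).
move=> /(is_coboundaryP 1)/(_ cob).
by rewrite scale1r subrK.
Qed.

End ExtComparison.

(** * Resolutions of length two defined by a relation [W U = U V] *)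

Section Projectives.
Variable R : pzRingType.

Lemma regular_projective : projective R^o.
Proof.
move=> V W g f g_surj; have [v gv] := g_surj (f 1).
have vL : linear (fun a : R^o => (a : R) *: v).
  by move=> c a b; rewrite scalerDl scalerA.
exists (linear_of vL) => a; rewrite /= linearZ gv -linearZ /=.
by congr (f _); exact: mulr1.
Qed.

Lemma prod_projective (P Q : lmodType R) :
  projective P -> projective Q -> projective (P * Q)%type.
Proof.
move=> P_proj Q_proj V W g f g_surj.
have iL : linear (fun p : P => (p, 0) : (P * Q)%type).
  by move=> c a b; congr pair; rewrite /= scaler0 addr0.
have jL : linear (fun q : Q => (0, q) : (P * Q)%type).
  by move=> c a b; congr pair; rewrite /= scaler0 addr0.
have [fP fPE] := P_proj _ _ g (f \o linear_of iL) g_surj.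
have [fQ fQE] := Q_proj _ _ g (f \o linear_of jL) g_surj.
have sL : linear (fun pq : (P * Q)%type => fP pq.1 + fQ pq.2).
  by move=> c a b; rewrite /= !linearP scalerDr addrACA.
exists (linear_of sL) => -[p q] /=; rewrite linearD fPE fQE /= -linearD.
by congr (f _); congr pair; rewrite ?addr0 ?add0r.
Qed.

Lemma zero_projective : projective 'rV[R]_0.
Proof.
move=> V W g f _; have zL : linear (fun _ : 'rV[R]_0 => 0 : V).
  by move=> c a b; rewrite scaler0 addr0.
by exists (linear_of zL) => p; rewrite /= (thinmx0 p) !linear0.
Qed.

End Projectives.

Section Koszul.
Variables (R : pzRingType) (M : lmodType R) (eps : {linear R^o -> M}) (U V W : R).

(** Row vectors of length 0 serve as the zero module in degrees above 2. *)
Definition koszul_obj (n : nat) : lmodType R :=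
  match n with
  | 0 | 2 => R^o
  | 1 => (R^o * R^o)%type
  | _ => 'rV[R]_0
  end.

Let d0 (ab : (R^o * R^o)%type) : R^o := (ab.1 : R) * U + (ab.2 : R) * V.
Let d1 (a : R^o) : (R^o * R^o)%type := ((a : R) * W, - ((a : R) * U)).
Let d2 (a : 'rV[R]_0) : R^o := 0.
Let d3 (a : 'rV[R]_0) : 'rV[R]_0 := 0.

Let d0_linear : linear d0.
Proof.
by move=> c a b; rewrite /d0 /= !mulrDl addrACA scalerDr -!mulrA.
Qed.

Let d1_linear : linear d1.
Proof.
move=> c a b; rewrite /d1; congr pair; first by rewrite mulrDl -mulrA.
rewrite mulrDl opprD -mulrA; congr (_ + _).
exact/esym/mulrN.
Qed.

Let d2_linear : linear d2.
Proof. by move=> c a b; rewrite scaler0 addr0. Qed.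

Let d3_linear : linear d3.
Proof. by move=> c a b; rewrite scaler0 addr0. Qed.

Definition koszul_diff (n : nat) : {linear koszul_obj n.+1 -> koszul_obj n} :=
  match n with
  | 0 => linear_of d0_linear
  | 1 => linear_of d1_linear
  | 2 => linear_of d2_linear
  | _ => linear_of d3_linear
  end.

Hypothesis WU : W * U = U * V.
Hypothesis eps_surj : forall m, exists a, eps a = m.
Hypothesis eps_exact : forall a, eps a = 0 <-> exists b c : R, b * U + c * V = a.
Hypothesis U_regular : forall a, a * U = 0 -> a = 0.
Hypothesis V_regular : forall a b, a * V = b * U -> exists c, a = c * U.

Let koszul_projective n : projective (koszul_obj n).
Proof.
case: n => [|[|[|n]]] /=; try exact: regular_projective; last exact: zero_projective.
exact/prod_projective/regular_projective/regular_projective.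
Qed.

Let koszul_aug_exact (a : koszul_obj 0) :
  eps a = 0 <-> exists b, koszul_diff 0 b = a.
Proof.
apply: iff_trans (eps_exact a) _; split=> [[b [c <-]]|[[b c] <-]]; first by exists (b, c).
by exists b, c.
Qed.

Let koszul_diff_exact n (p : koszul_obj n.+1) :
  koszul_diff n p = 0 <-> exists q, koszul_diff n.+1 q = p.
Proof.
case: n p => [|[|[|n]]] p /=.
- case: p => a b; rewrite /d0 /d1 /=; split=> [ab0|[c [<- <-]]]; last first.
    by rewrite -mulrA WU mulrA mulNr subrr.
  have bV : b * V = (- a) * U.
    by rewrite mulNr; apply/eqP; rewrite -addr_eq0 addrC ab0.
  (* With [b = c U], the relation [W U = U V] turns [a U + b V = 0] into [(a + c W) U = 0], whence
     [a = - c W]. *)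
  have [c bE] := V_regular bV; exists (- c).
  rewrite [- c * U]mulNr opprK -bE; congr pair.
  apply/eqP; rewrite -subr_eq0; apply/eqP/U_regular.
  by rewrite mulrBl -mulrA WU mulrA !mulNr -bE bV mulNr opprK subrr.
- rewrite /d1 /d2; split=> [[_ /eqP]|[_ <-]]; last first.
    by congr pair; rewrite mul0r ?oppr0.
  by rewrite oppr_eq0 => /eqP/U_regular->; exists 0.
- by rewrite /d2 /d3; split=> // _; exists 0; rewrite (thinmx0 p).
- by rewrite /d3; split=> // _; exists 0; rewrite (thinmx0 p).
Qed.

Definition koszul_resolution : projective_resolution M :=
  @Build_projective_resolution R M koszul_obj koszul_diff eps
    koszul_projective eps_surj koszul_aug_exact koszul_diff_exact.

End Koszul.

(** * Ext groups read off the resolution of length two *)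

Section KoszulExt.
Variables (k : pzRingType) (R : algType k) (M N : lmodType R).
Variables (eps : {linear R^o -> M}) (U V W : R).
Hypothesis WU : W * U = U * V.
Hypothesis eps_surj : forall m, exists a, eps a = m.
Hypothesis eps_exact : forall a, eps a = 0 <-> exists b c : R, b * U + c * V = a.
Hypothesis U_regular : forall a, a * U = 0 -> a = 0.
Hypothesis V_regular : forall a b, a * V = b * U -> exists c, a = c * U.

Let P := koszul_resolution WU eps_surj eps_exact U_regular V_regular.
Local Notation kN := (restrict_scalars N).

Let ev (f : Hom R^o N) : kN := val f 1.
Let ev_linear : linear ev. Proof. by []. Qed.

Let evE (f : Hom R^o N) (a : R) : val f a = a *: (ev f : N).
Proof.
rewrite /ev -[a in LHS]mulr1 -[a * 1]addr0.
by rewrite (hom_linear f a 1 0) hom0 addr0.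
Qed.

Let hom_of_is_hom (n : N) : is_hom (fun a : R^o => (a : R) *: n : kN).
Proof. by move=> c a b; rewrite scalerDl scalerA. Qed.
Let hom_of (n : N) : Hom R^o N := in_sub (U := hom_submodule _ _) (hom_of_is_hom n).

Let ev_hom_of n : ev (hom_of n) = n.
Proof. exact: (scale1r (n : N)). Qed.

Let ev2 (f : Hom (R^o * R^o)%type N) : (kN * kN)%type := (val f (1, 0), val f (0, 1)).
Let ev2_linear : linear ev2. Proof. by []. Qed.

Let ev2E (f : Hom (R^o * R^o)%type N) (a b : R) :
  val f (a, b) = a *: ((ev2 f).1 : N) + b *: ((ev2 f).2 : N).
Proof.
have <- : (a : R^o) *: ((1 : R^o), (0 : R^o)) + (b *: ((0 : R^o), (1 : R^o)) + 0)
    = ((a : R^o), (b : R^o)).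
  by congr pair; rewrite /= !scaler0 !addr0 ?add0r; exact: mulr1.
by rewrite !(hom_linear f) hom0 addr0.
Qed.

Let hom_of2_is_hom (u v : N) :
  is_hom (fun p : (R^o * R^o)%type => (p.1 : R) *: u + (p.2 : R) *: v : kN).
Proof. by move=> c p q; rewrite /= !scalerDl scalerDr !scalerA addrACA. Qed.
Let hom_of2 (u v : N) : Hom (R^o * R^o)%type N :=
  in_sub (U := hom_submodule _ _) (hom_of2_is_hom u v).

Let ev2_hom_of2 u v : ev2 (hom_of2 u v) = (u, v).
Proof. by congr pair; rewrite /= scale0r scale1r ?addr0 ?add0r. Qed.

Local Notation delta := (fun i => hom_map (N := N) (res_diff P i)).

Let delta0E f : ev2 (hom_map (N := N) (koszul_diff U V W 0) f)
  = (U *: (ev f : N), V *: (ev f : N)).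
Proof.
congr pair; rewrite hom_mapE evE /= mul1r mul0r; first by rewrite addr0.
by rewrite add0r.
Qed.

Let delta1E f : ev (hom_map (N := N) (koszul_diff U V W 1) f)
  = W *: ((ev2 f).1 : N) - U *: ((ev2 f).2 : N).
Proof.
rewrite /ev hom_mapE -scaleNr -ev2E; congr (val f _); congr pair.
  exact: mul1r.
by congr (- _); exact: mul1r.
Qed.

Let ev_inj : injective ev.
Proof. by move=> f g fg; apply: hom_eqP => a; rewrite !evE fg. Qed.
Let ev2_inj : injective ev2.
Proof. by move=> f g fg; apply: hom_eqP => -[a b]; rewrite !ev2E fg. Qed.

Let val_linear n : linear (val : cocycle delta n -> Hom (P n) N).
Proof. by []. Qed.

Lemma Ext_koszul_iso n (L : lmodType k) (g : {linear cocycle delta n -> L}) :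
    (forall w, exists z, g z = w) ->
    (forall z, g z = 0 <-> is_coboundary delta (val z)) ->
  lin_iso (Ext n M N) L.
Proof.
move=> g_surj g_ker; apply: lin_iso_trans (Ext_of_resolution N _ P n) _.
exact: (quotient_lin_iso (U := coboundary delta n) g_surj g_ker).
Qed.

(** Here and in degrees 1 and 2, evaluation at the basis vectors turns cochains into elements of [N]
    or pairs of them. The map [g] is linear on all of these, while the kernel condition on it
    concerns cocycles only. *)
Lemma Ext0_koszul (L : lmodType k) (g : {linear kN -> L}) :
    (forall w, exists n : N, [/\ U *: n = 0, V *: n = 0 & g n = w]) ->
    (forall n : N, U *: n = 0 -> V *: n = 0 -> g n = 0 -> n = 0) ->
  lin_iso (Ext 0 M N) L.
Proof.
move=> g_surj g_inj.
pose gz : {linear cocycle delta 0 -> L} :=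
  g \o (linear_of ev_linear \o linear_of (@val_linear 0)).
apply: (@Ext_koszul_iso 0 _ (gz)) => [w|z].
  have [n [Un Vn gn]] := g_surj w.
  have dn : hom_map (N := N) (koszul_diff U V W 0) (hom_of n) = 0.
    by apply: ev2_inj; rewrite delta0E ev_hom_of Un Vn.
  by exists (in_sub (U := ker_submodule (delta 0%N)) dn); rewrite /= ev_hom_of.
have := congr1 ev2 (submodule_valP z); rewrite delta0E => -[Uz Vz].
split=> [/(g_inj _ Uz Vz) z0|/= ->]; first exact: ev_inj.
exact: (linear0 g).
Qed.

Lemma Ext1_koszul (L : lmodType k) (g : {linear (kN * kN)%type -> L}) :
    (forall w, exists u v : N, W *: u = U *: v /\ g (u, v) = w) ->
    (forall u v : N, W *: u = U *: v ->
       g (u, v) = 0 <-> exists n : N, u = U *: n /\ v = V *: n) ->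
  lin_iso (Ext 1 M N) L.
Proof.
move=> g_surj g_ker.
pose gz : {linear cocycle delta 1 -> L} :=
  g \o (linear_of ev2_linear \o linear_of (@val_linear 1)).
apply: (@Ext_koszul_iso 1 _ (gz)) => [w|z].
  have [u [v [uv gn]]] := g_surj w.
  have dn : hom_map (N := N) (koszul_diff U V W 1) (hom_of2 u v) = 0.
    by apply: ev_inj; rewrite delta1E ev2_hom_of2 /= uv subrr.
  by exists (in_sub (U := ker_submodule (delta 1%N)) dn); rewrite /= ev2_hom_of2.
have := congr1 ev (submodule_valP z); rewrite delta1E => /subr0_eq uv.
apply: iff_trans (g_ker _ _ uv) _; split=> [[n [un vn]]|[f fz]].
  exists (hom_of n); apply: ev2_inj; rewrite /= delta0E ev_hom_of -un -vn.
  by case: (ev2 _).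
by exists (ev f); have := delta0E f; rewrite fz => ->.
Qed.

Lemma Ext2_koszul (L : lmodType k) (g : {linear kN -> L}) :
    (forall w, exists n, g n = w) ->
    (forall n : N, g n = 0 <-> exists u v : N, n = W *: u - U *: v) ->
  lin_iso (Ext 2 M N) L.
Proof.
move=> g_surj g_ker.
pose gz : {linear cocycle delta 2 -> L} :=
  g \o (linear_of ev_linear \o linear_of (@val_linear 2)).
apply: (@Ext_koszul_iso 2 _ (gz)) => [w|z].
  have [n gn] := g_surj w.
  have dn : hom_map (N := N) (koszul_diff U V W 2) (hom_of n) = 0.
    by apply: hom_eqP => p; rewrite hom_mapE hom0.
  by exists (in_sub (U := ker_submodule (delta 2%N)) dn); rewrite /= ev_hom_of.
apply: iff_trans (g_ker _) _; split=> [[u [v uv]]|[f fz]].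
  by exists (hom_of2 u v); apply: ev_inj; rewrite /= delta1E ev2_hom_of2; exact: esym uv.
exists (ev2 f).1, (ev2 f).2; rewrite -delta1E; exact: (congr1 ev (esym fz)).
Qed.

Lemma Ext_ge3_koszul n : (2 < n)%N -> forall z : Ext n M N, z = 0.
Proof.
case: n => [|[|[|n]]] // _ z.
have [e e_bij] := Ext_of_resolution N (free_resolution M) P n.+3.
apply: (bij_inj e_bij); rewrite linear0; have [f ->] := quot_class_surj (e z).
rewrite -[0](linear0 (quot_class (coboundary delta n.+3))).
congr (quot_class _ _); apply/val_inj/hom_eqP => p.
by rewrite (thinmx0 p) !hom0.
Qed.

End KoszulExt.

(** * Normal forms in [k<x, y>/(yx - xy - h)] *)

Lemma poly_sum_coef (R : nzRingType) (p : {poly R}) n : (size p <= n)%N ->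
  p = \sum_(j < n) p`_j *: 'X^j.
Proof.
move=> pn; rewrite -poly_def; apply/polyP => i; rewrite coef_poly.
by case: ltnP => // /(leq_trans pn)/(nth_default 0).
Qed.

(** Used to show that coefficients vanish, starting from indices beyond a finite support. *)
Lemma downward_ind (P : nat -> Prop) N :
  (forall n, (N <= n)%N -> P n) -> (forall n, P n.+1 -> P n) -> forall n, P n.
Proof.
move=> PN PS n; case: (leqP N n) => [/PN//|/ltnW nN].
rewrite -(subKn nN); elim: (N - n)%N => [|m IH]; first by rewrite subn0; exact: PN.
case: (ltnP m N) => mN; first by apply: PS; rewrite -subSn.
by have := IH; rewrite (eqP mN) (eqP (leqW mN)).
Qed.

Lemma size_coefs (R : nzRingType) (p : {poly {poly R}}) :
  exists N, (size p <= N)%N /\ forall j, (size (p`_j)%R <= N)%N.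
Proof.
exists (maxn (size p) (\max_(j < size p) size (p`_j)%R)); rewrite leq_maxl; split=> // j.
case: (ltnP j (size p)) => [jp|/(nth_default 0)->]; last by rewrite size_poly0.
by rewrite leq_max (bigmax_sup (Ordinal jp)) ?orbT.
Qed.

Lemma horner_alg_sum (k : fieldType) (A : algType k) (x : A) (s : {poly k}) n :
  (size s <= n)%N ->
  horner_alg x s = \sum_(i < n) s`_i *: x ^+ i.
Proof.
move=> sn; rewrite {1}(poly_sum_coef sn) raddf_sum; apply: eq_bigr => i _ /=.
by rewrite -mul_polyC rmorphM rmorphXn /= horner_algC horner_algX -scalerAl mul1r.
Qed.

Section NormalForm.
Variables (k : fieldType) (A : algType k) (x y : A).
Local Notation S := {poly k}.
Local Notation iota := (horner_alg x).

(** Since [x] and [y] do not commute, order matters: Horner evaluation at [y] puts the coefficients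
    in [k[x]] to the left of the powers of [y]. *)
Definition normal_form (p : {poly S}) : A := (map_poly iota p).[y].
Local Notation Phi := normal_form.

Fact normal_form_zmod_morphism : zmod_morphism Phi.
Proof. by move=> p q; rewrite /Phi rmorphB hornerD hornerN. Qed.
HB.instance Definition _ := GRing.isZmodMorphism.Build {poly S} A Phi
  normal_form_zmod_morphism.

Lemma normal_form0 : Phi 0 = 0. Proof. exact: raddf0. Qed.

Lemma normal_formD : {morph Phi : p q / p + q}. Proof. exact: raddfD. Qed.

Lemma normal_formN : {morph Phi : p / - p}. Proof. exact: raddfN. Qed.

Lemma normal_formC s : Phi s%:P = iota s.
Proof. by rewrite /Phi map_polyC hornerC. Qed.

Lemma normal_formMX p : Phi (p * 'X) = Phi p * y.
Proof. by rewrite /Phi rmorphM /= map_polyX hornerMX. Qed.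

Lemma normal_formZ s p : Phi (s *: p) = iota s * Phi p.
Proof. by rewrite /Phi map_polyZ hornerZ. Qed.

Lemma normal_formXn n : Phi 'X^n = y ^+ n.
Proof. by rewrite /Phi map_polyXn hornerXn. Qed.

Lemma normal_form_sum (p : {poly S}) n : (size p <= n)%N ->
  Phi p = \sum_(j < n) iota p`_j * y ^+ j.
Proof.
move=> pn; rewrite {1}(poly_sum_coef pn) raddf_sum.
by apply: eq_bigr => j _ /=; rewrite normal_formZ normal_formXn.
Qed.

Definition deriv_coefs (p : {poly S}) : {poly S} := map_poly (@deriv k) p.

Lemma coef_deriv_coefs p i : (deriv_coefs p)`_i = (p`_i)^`().
Proof. by rewrite coef_map_id0 ?deriv0. Qed.

Fact deriv_coefs_zmod_morphism : zmod_morphism deriv_coefs.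
Proof. by move=> p q; apply/polyP => i; rewrite coefB !coef_deriv_coefs coefB derivB. Qed.
HB.instance Definition _ := GRing.isZmodMorphism.Build {poly S} {poly S} deriv_coefs
  deriv_coefs_zmod_morphism.

Variable h : S.

(* Left multiplication by [x] and by [y], read on normal forms. *)
Definition x_op (p : {poly S}) : {poly S} := 'X *: p.
Definition y_op (p : {poly S}) : {poly S} := 'X * p + h *: deriv_coefs p.

Hypothesis yx : y * x = x * y + iota h.

(** The commutator with [y] is a derivation sending [x] to [h], so on polynomials in [x] it is
    [h d/dx]. *)
Lemma y_horner_alg s : y * iota s = iota s * y + iota (h * s^`()).
Proof.
elim/poly_ind: s => [|s c IH]; first by rewrite deriv0 mulr0 !rmorph0 mulr0 mul0r addr0.
rewrite derivD derivC addr0 derivM derivX mulr1 rmorphD rmorphM /= horner_algX.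
rewrite mulrDr mulrA IH !mulrDl -!mulrA yx.
have -> : y * iota c%:P = iota c%:P * y.
  by rewrite horner_algC -scalerAr -scalerAl mulr1 mul1r.
rewrite mulrDr -!addrA; congr (_ + _); rewrite addrA [RHS]addrC; congr (_ + _).
by rewrite -[X in _ + _ * X](horner_algX x) -!rmorphM -!rmorphD /=; congr (iota _); ring.
Qed.

Lemma normal_form_x p : x * Phi p = Phi (x_op p).
Proof. by rewrite normal_formZ horner_algX. Qed.

Lemma normal_form_y p : y * Phi p = Phi (y_op p).
Proof.
rewrite /y_op.
elim/poly_ind: p => [|p c IH]; first by rewrite !(raddf0, mulr0, scaler0, addr0).
have -> : 'X * (p * 'X + c%:P) + h *: deriv_coefs (p * 'X + c%:P) =
    ('X * p + h *: deriv_coefs p) * 'X + (c%:P * 'X + (h * c^`())%:P).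
  have -> : deriv_coefs (p * 'X + c%:P) = deriv_coefs p * 'X + (c^`())%:P.
    apply/polyP => i; rewrite coef_deriv_coefs !coefD !coefMX !coefC derivD.
    by case: i => [|i] /=; rewrite ?deriv0 ?coef_deriv_coefs.
  by rewrite scalerDr -!mul_polyC polyCM; ring.
rewrite 2!raddfD /= !normal_formMX normal_formC mulrDr mulrA IH; congr (_ + _).
by rewrite raddfD /= normal_formMX !normal_formC y_horner_alg.
Qed.

Lemma normal_form_y_bracket p : y * Phi p - Phi p * y = Phi (h *: deriv_coefs p).
Proof.
by rewrite normal_form_y /y_op -normal_formMX raddfD /= mulrC addrAC subrr add0r.
Qed.

(* Brackets with [x] are divisible by [h]; this is the quotient of [[y^n, x]]. *)
Fixpoint xpow_bracket n : {poly S} :=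
  if n is m.+1 then
    'X^m + 'X * xpow_bracket m + deriv_coefs (h *: xpow_bracket m)
  else 0.

Lemma normal_form_xpow_bracket n : x * y ^+ n - y ^+ n * x = - Phi (h *: xpow_bracket n).
Proof.
elim: n => [|n IH] /=; first by rewrite mulr1 mul1r subrr !(raddf0, scaler0, oppr0).
have E : y ^+ n * x = x * y ^+ n + Phi (h *: xpow_bracket n).
  by apply/eqP; rewrite addrC -subr_eq -opprB IH opprK.
(* Writing [b] for [xpow_bracket n], [y^(n+1) x = y (x y^n + h b) = x y^(n+1) + h y^n + y (h b)],
   and [y_op] expands the last term into the recursion. *)
apply/eqP; rewrite -opprB eqr_opp subr_eq addrC exprS -mulrA E mulrDr.
rewrite normal_form_y mulrA yx mulrDl mulrA -addrA; apply/eqP; congr (_ + _).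
rewrite -normal_formXn -normal_formZ -raddfD /y_op /=; congr (Phi _).
by rewrite -!mul_polyC; ring.
Qed.

Lemma size_xpow_bracket n : (size (xpow_bracket n) <= n)%N.
Proof.
elim: n => [|n IH] /=; first by rewrite size_poly0.
apply/leq_sizeP => i ni; rewrite !coefD coefXn coefXM coef_deriv_coefs coefZ.
rewrite gtn_eqF // (nth_default 0 (leq_trans IH (ltnW ni))) mulr0 deriv0 addr0 add0r.
by case: i ni => //= i ni; rewrite nth_default // (leq_trans IH).
Qed.

(** The term ['X^n] adds one at each stage, and the derivative term has too low a degree. In
    characteristic zero this coefficient is invertible, which controls the kernel and the image of
    [[x, -]]. *)
Lemma lead_xpow_bracket n : (xpow_bracket n.+1)`_n = n.+1%:R.
Proof.
elim: n => [|n IH].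
  by rewrite /= !(scaler0, mulr0, raddf0, addr0) coef1.
rewrite -[xpow_bracket _]/('X^(n.+1) + 'X * xpow_bracket n.+1 +
  deriv_coefs (h *: xpow_bracket n.+1)).
rewrite !coefD coefXn eqxx coefXM IH coef_deriv_coefs coefZ.
by rewrite nth_default ?size_xpow_bracket // mulr0 deriv0 !addr0 /= [RHS]mulrS.
Qed.

(** When [n] bounds the size of [p], this is the quotient of [[p, x]] by [h]. *)
Definition x_bracket (p : {poly S}) n : {poly S} := \sum_(j < n) p`_j *: xpow_bracket j.

Lemma normal_form_x_bracket (p : {poly S}) n : (size p <= n)%N ->
  x * Phi p - Phi p * x = - Phi (h *: x_bracket p n).
Proof.
move=> pn; rewrite {1 2}(poly_sum_coef pn) raddf_sum mulr_sumr mulr_suml.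
rewrite -sumrB /x_bracket scaler_sumr raddf_sum -sumrN.
apply: eq_bigr => j _ /=; rewrite [h *: _]scalerA [h * _]mulrC -scalerA.
rewrite ![Phi (p`_j *: _)]normal_formZ -[RHS]mulrN -normal_form_xpow_bracket.
rewrite mulrBr normal_formXn !mulrA; congr (_ * _ - _).
rewrite -[X in X * _](horner_algX x) -[X in _ = _ * X](horner_algX x).
by rewrite -!rmorphM /= mulrC.
Qed.

Lemma size_x_bracket p n : (size (x_bracket p n.+1) <= n)%N.
Proof.
apply: (leq_trans (size_sum _ _ _)); apply/bigmax_leqP => j _.
by rewrite (leq_trans (size_scale_leq _ _)) // (leq_trans (size_xpow_bracket j)) // -ltnS.
Qed.

Lemma lead_x_bracket p n : (x_bracket p n.+2)`_n = n.+1%:R * p`_n.+1.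
Proof.
rewrite coef_sum big_ord_recr big1 => [|j _]; last first.
  by rewrite coefZ [_`_n]nth_default ?mulr0 // (leq_trans (size_xpow_bracket j)) // -ltnS.
by rewrite [LHS]add0r coefZ lead_xpow_bracket mulrC.
Qed.

End NormalForm.

(** * Quotients of [k[x]] *)

Section Polynomials.
Variable k : fieldType.
Implicit Types p q s t : {poly k}.

(** Divide by the gcd: the two cofactors are coprime, so Gauss's lemma removes the one coming from
    the derivative. *)
Lemma dvdp_deriv_coprime p s : p != 0 ->
  (p %| p^`() * s) = (p %/ gcdp p p^`() %| s).
Proof.
move=> p0; set d := gcdp p p^`().
have d0 : d != 0 by rewrite gcdp_eq0 negb_and p0.
have co : coprimep (p %/ d) (p^`() %/ d) by rewrite coprimep_div_gcd ?p0.
rewrite -(Gauss_dvdpr s co) -[LHS](_ : p %/ d * d %| p^`() %/ d * d * s = _).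
  by rewrite mulrAC dvdp_mul2r.
by rewrite !divpK ?dvdp_gcdl ?dvdp_gcdr.
Qed.

Lemma gcdp_Bezout p q : exists s t, gcdp p q = s * p + t * q.
Proof.
have [[s t] /= E] := Bezoutp p q.
have /eqpP[[c c'] /= /andP[c0 c'0] E'] := E.
exists (c'^-1 *: (c *: s)), (c'^-1 *: (c *: t)).
by rewrite -!scalerAl -!scalerDr E' scalerA mulVf // scale1r.
Qed.

Lemma in_principal_ideal p s : in_ideal (fun r => r = p) s <-> p %| s.
Proof.
split=> [|/dvdpP[q ->]]; last by rewrite -[q * p]mulr1; apply/IdealM/IdealGen.
elim=> [_ ->||u v _ pu _ pv|a u b _ pu].
- exact: dvdpp.
- exact: dvdp0.
- by rewrite dvdp_add.
- by rewrite dvdp_mulr ?dvdp_mull.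
Qed.

Lemma poly_class_eq0 p s : ideal_class (fun r : {poly k} => r = p) s = 0 <-> p %| s.
Proof.
rewrite -[0](raddf0 (ideal_class (fun r : {poly k} => r = p))).
by apply: iff_trans (ideal_classP _ _ _) _; rewrite subr0; exact: in_principal_ideal.
Qed.

Lemma dvdp_coefs p (P : {poly {poly k}}) :
  (exists Q, P = p *: Q) <-> (forall j, p %| P`_j).
Proof.
split=> [[Q ->] j|pP]; first by rewrite coefZ dvdp_mulr.
exists (\poly_(j < size P) (P`_j %/ p)); apply/polyP => j.
rewrite coefZ coef_poly; case: ltnP => [_|/(nth_default 0)->]; last by rewrite mulr0.
by rewrite mulrC divpK.
Qed.

Hypothesis char0 : [pchar k] =i pred0.

Lemma deriv_eq0 s : s^`() = 0 -> s = (s`_0)%:P.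
Proof.
move=> s0; apply/polyP => -[|i]; rewrite coefC //=.
have := coef_deriv s i; rewrite s0 coef0 => /esym/eqP.
by rewrite -mulr_natr mulf_eq0 ((pcharf0P k).1 char0) orbF => /eqP.
Qed.

Lemma deriv_surj s : exists t, t^`() = s.
Proof.
(* At [i = 0] the quotient is a division by zero, hence 0; the derivative ignores this
   coefficient. *)
exists (\poly_(i < (size s).+1) (s`_i.-1 / i%:R)); apply/polyP => i.
rewrite coef_deriv coef_poly ltnS; case: ltnP => [_|/(nth_default 0)->] /=.
  by rewrite -[LHS]mulr_natr divfK // ((pcharf0P k).1 char0).
by rewrite mul0rn.
Qed.

End Polynomials.

(** * Polynomials in [y] with coefficients in a quotient of [k[x]] *)

Section PolysInY.
Variables (k : fieldType) (W : lmodType k) (f : {linear {poly k} -> W}).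

Definition map_in_y (p : {poly {poly k}}) : polys_in_y W :=
  \sum_(j < size p) (<< f p`_j *g (j : nat) >> : polys_in_y W).

Lemma map_in_yE p j : (map_in_y p)@_j = f p`_j.
Proof.
rewrite /map_in_y raddf_sum /=.
under eq_bigr => i _ do rewrite mcoeffU.
case: (ltnP j (size p)) => [jp|pj].
  rewrite (bigD1 (Ordinal jp)) //= eqxx mulr1n big1 ?addr0 // => i ij.
  by case: eqP => // E; case/eqP: ij; apply/val_inj.
rewrite nth_default // linear0 big1 // => i _.
by case: eqP => // E; move: pj; rewrite -E leqNgt ltn_ord.
Qed.

Lemma map_in_y_linear (c : k) (p q : {poly {poly k}}) :
  map_in_y (c%:P *: p + q) = c *: map_in_y p + map_in_y q.
Proof.
apply/malgP => j; rewrite mcoeffD fsuppZE !map_in_yE coefD coefZ mul_polyC.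
exact: linearP.
Qed.

(** [Q] constrains the lifted coefficients: it is divisibility by [h/d] in degree one of the
    cohomology and trivial in degree two. *)
Lemma map_in_y_surj (Q : {poly k} -> Prop) : Q 0 ->
    (forall w, exists s, Q s /\ f s = w) ->
  forall w, exists p : {poly {poly k}}, (forall j, Q p`_j) /\ map_in_y p = w.
Proof.
move=> Q0 /choice[c cP] w.
pose N := (\max_(j <- msupp w) j.+1)%N.
exists (\poly_(j < N) c w@_j); split=> [j|].
  by rewrite coef_poly; case: ifP => // _; exact: (cP _).1.
apply/malgP => j; rewrite map_in_yE coef_poly; case: ltnP => [_|Nj].
  exact: (cP _).2.
rewrite linear0 mcoeff_outdom //; apply/negP => jw; move: Nj.
by rewrite leqNgt => /negP; apply; exact: (leq_bigmax_seq (F := succn)).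
Qed.

Lemma map_in_y_eq0 (p : {poly {poly k}}) : map_in_y p = 0 <-> forall j, f p`_j = 0.
Proof.
split=> [p0 j|p0]; first by rewrite -map_in_yE p0 mcoeff0.
by apply/malgP => j; rewrite map_in_yE p0 mcoeff0.
Qed.

End PolysInY.

Section QuotientIdeal.
Variables (k : fieldType) (h e : {poly k}).
Local Notation I := (poly_quotient_ideal h e).
Local Notation cls := (ideal_class (fun r : {poly k} => r = h)).

(** Replacing [s] by the multiple [e * (s %/ e)] gives a map defined on all of [k[x]]; it is linear
    because Euclidean division by [e] is linear in the dividend. *)
Let Ie s : ideal_of_quotient (fun a => a = cls e) (cls (e * (s %/ e))).
Proof.
have -> : cls (e * (s %/ e)) = cls (s %/ e) * cls e * 1.
  by rewrite mulr1 -ideal_classM mulrC.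
exact/IdealM/IdealGen.
Qed.

(* On the multiples of [e] this is the reduction modulo [h]. *)
Definition to_quotient_ideal s : I := in_sub (Ie s).

Fact to_quotient_ideal_linear : linear to_quotient_ideal.
Proof.
move=> c s t; apply: val_inj => /=.
by rewrite divpD divpZl mulrDr -scalerAr linearP.
Qed.

Lemma to_quotient_ideal_eq0 s : e %| s -> to_quotient_ideal s = 0 <-> h %| s.
Proof.
move=> es; apply: iff_trans (poly_class_eq0 h s).
have E : val (to_quotient_ideal s) = cls s by rewrite /= mulrC divpK.
by split=> [s0|s0]; [rewrite -E s0|apply: val_inj; rewrite E s0].
Qed.

Lemma to_quotient_ideal_surj (w : I) : exists s, e %| s /\ to_quotient_ideal s = w.
Proof.
have [t tE] : exists t, val w = cls (t * e).
  have := submodule_valP w; rewrite /=.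
  elim=> [_ ->||a b _ [t ->] _ [t' ->]|a b c _ [t ->]].
  - by exists 1; rewrite mul1r.
  - by exists 0; rewrite mul0r raddf0.
  - by exists (t + t'); rewrite mulrDl raddfD.
  have [a' ->] := ideal_class_surj a; have [c' ->] := ideal_class_surj c.
  exists (a' * t * c'); rewrite -(ideal_classM _ a') -(ideal_classM _ (a' * _) c').
  by congr (cls _); ring.
exists (t * e); rewrite dvdp_mull //; split=> //; apply: val_inj.
by rewrite tE /= [e * _]mulrC divpK // dvdp_mull.
Qed.

End QuotientIdeal.

(** * The resolution of [A] over its enveloping algebra *)

Section BimoduleRelations.
Variables (k : fieldType) (A : algType k) (R : pzRingType) (l r : A -> R).
Hypothesis lD : {morph l : a b / a + b}.
Hypothesis rD : {morph r : a b / a + b}.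
Hypothesis lM : {morph l : a b / a * b}.
Hypothesis rM : forall a b, r (a * b) = r b * r a.
Hypothesis lrC : forall a b, l a * r b = r b * l a.
Hypothesis lrZ : forall c : k, l (c *: 1) = r (c *: 1).

Definition bracket (a : A) : R := l a - r a.

Lemma bracketM a b : bracket (a * b) = r b * bracket a + l a * bracket b.
Proof. by rewrite /bracket lM rM !mulrBr lrC [RHS]addrC addrA subrK. Qed.

Lemma bracketD a b : bracket (a + b) = bracket a + bracket b.
Proof. by rewrite /bracket lD rD opprD addrACA. Qed.

Lemma bracketZ1 c : bracket (c *: 1) = 0.
Proof. by rewrite /bracket lrZ subrr. Qed.

Lemma bracket0 : bracket 0 = 0.
Proof. by rewrite -[0](scale0r 1) bracketZ1. Qed.

Lemma bracketN a : bracket (- a) = - bracket a.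
Proof. by apply/eqP; rewrite -addr_eq0 -bracketD addNr bracket0. Qed.

(** Left and right multiplications commute with each other, and [r] reverses products, so the
    commutator of the two right parts is minus [r] of the commutator. *)
Lemma bracket_comm a b :
  bracket a * bracket b - bracket b * bracket a = bracket (a * b - b * a).
Proof.
rewrite bracketD bracketN !bracketM.
rewrite -[bracket a * _]/((l a - r a) * _) -[bracket b * bracket a]/((l b - r b) * _).
move: (bracket a) (bracket b) => p q; rewrite !mulrBl !opprD opprK.
by rewrite addrACA [RHS]addrACA [RHS]addrC [- (r a * q) + _]addrC.
Qed.

Variables (x y : A) (h : {poly k}).
Local Notation iota := (horner_alg x).
Hypothesis yx : y * x = x * y + iota h.

Variable N : lmodType R.
Hypothesis bracket_x_N : forall u : N, exists v, bracket x *: u = l (iota h) *: v.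

(* [Delta] is the noncommutative difference quotient of [s]. *)
Lemma bracket_horner_alg s : exists Delta : R,
  Delta * bracket x = bracket (iota s) /\
  forall u : N, exists v, Delta *: u = l (iota s^`()) *: u + l (iota h) *: v.
Proof.
have l0 : l 0 = 0 by apply: (addIr (l 0)); rewrite -lD !add0r.
elim/poly_ind: s => [|s c [D [DE DN]]].
  exists 0; rewrite mul0r rmorph0 bracket0; split=> // u; exists 0.
  by rewrite deriv0 rmorph0 l0 !scale0r scaler0 addr0.
(* This is the Leibniz rule for [s * x]. On [N], [r x] agrees with [l x] up to [bracket x], whose
   values are multiples of [h]. *)
exists (r x * D + l (iota s)); split.
  rewrite rmorphD rmorphM /= horner_algX horner_algC bracketD bracketZ1 addr0.
  by rewrite bracketM mulrDl -mulrA DE.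
move=> u; have [v vE] := DN u; have [w wE] := bracket_x_N u.
exists (r x *: v - l (iota s^`()) *: w).
have E t : l (iota t) *: (l (iota h) *: w) = l (iota h) *: (l (iota t) *: w).
  by rewrite !scalerA -!lM -!rmorphM /= mulrC.
rewrite derivD derivC addr0 derivM derivX mulr1 rmorphD rmorphM /= horner_algX lD lM.
rewrite scalerDl -scalerA vE scalerDr scalerBr -E -wE /bracket scalerBl.
rewrite !scalerA scalerBr !scalerA -!lrC scalerDl.
set p := (l _ * l _) *: u; set q := l (iota s) *: u.
set e := (l _ * r x) *: v; set f := (l _ * r x) *: u.
by rewrite opprB [RHS]addrC [RHS]addrA -[e + _ + p]addrA subrK [e + f]addrC.
Qed.

(** Take [W = bracket y - D], where [D] is the difference quotient of [h]: then [D * bracket x] is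
    the bracket of [h = [y, x]], that is, the commutator of [bracket y] and [bracket x]. *)
Lemma koszul_relation : exists W : R,
  W * bracket x = bracket x * bracket y /\
  forall u : N, exists v,
    W *: u = bracket y *: u - l (iota h^`()) *: u - l (iota h) *: v.
Proof.
have [D [DE DN]] := bracket_horner_alg h; exists (bracket y - D); split.
  have := bracket_comm y x; rewrite yx [x * y + _]addrC addrK -DE mulrBl => <-.
  by rewrite opprB addrC subrK.
move=> u; have [v vE] := DN u; exists v.
by rewrite scalerBl vE opprD addrA.
Qed.

End BimoduleRelations.

(* [R] stands for [A (x) A^op] and [env a b] for [a (x) b]; keeping them
   abstract shields the computations from the construction of the tensor
   product. *)
Section TensorAlgebra.
Variables (k : fieldType) (A R : algType k) (env : A -> A -> R).
Hypothesis env_linear_l : forall b, linear (env^~ b).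
Hypothesis env_linear_r : forall a, linear (env a).
Hypothesis envM : forall a b c d, env a b * env c d = env (a * c) (d * b).
Hypothesis env_ind : forall P : R -> Prop,
  (forall r s, P r -> P s -> P (r + s)) -> (forall a b, P (env a b)) ->
  forall r, P r.
Variable contract : {linear A -> A} -> {linear R -> A}.
Hypothesis contractE : forall f a b, contract f (env a b) = a * f b.

Local Notation br := (bracket (env^~ 1) (env 1)).

Lemma envDl b : {morph env^~ b : a c / a + c}.
Proof. exact: (raddfD (linear_of (@env_linear_l b))). Qed.

Lemma envDr a : {morph env a : b c / b + c}.
Proof. exact: (raddfD (linear_of (@env_linear_r a))). Qed.

Lemma env_sumr (I : Type) (rs : seq I) (P : pred I) (F : I -> A) a :
  env a (\sum_(i <- rs | P i) F i) = \sum_(i <- rs | P i) env a (F i).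
Proof. exact: (raddf_sum (linear_of (@env_linear_r a))). Qed.

Lemma env0l b : env 0 b = 0.
Proof. by apply: (addIr (env 0 b)); rewrite -envDl !add0r. Qed.

Lemma env0r a : env a 0 = 0.
Proof. by apply: (addIr (env a 0)); rewrite -envDr !add0r. Qed.

Lemma envZl t a b : env (t *: a) b = t *: env a b.
Proof. by have := env_linear_l b t a 0; rewrite env0l !addr0. Qed.

Lemma envZr t a b : env a (t *: b) = t *: env a b.
Proof. by have := env_linear_r a t b 0; rewrite env0r !addr0. Qed.

Lemma envM1l a b : env (a * b) 1 = env a 1 * env b 1.
Proof. by rewrite envM mulr1. Qed.

Lemma envM1r a b : env 1 (a * b) = env 1 b * env 1 a.
Proof. by rewrite envM mulr1. Qed.

Lemma env1C a b : env a 1 * env 1 b = env 1 b * env a 1.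
Proof. by rewrite !envM !mulr1 !mul1r. Qed.

Lemma envZ1 (t : k) : env (t *: 1) 1 = env 1 (t *: 1).
Proof. by rewrite envZl envZr. Qed.

Lemma env_mul_bracket a b w : env a b * br w = env (a * w) b - env a (w * b).
Proof. by rewrite /bracket mulrBr !envM mul1r mulr1. Qed.

(** Turns right multiplication by a bracket in [R] into a recursion between left [A]-linear
    functionals; it is used for coordinates with consecutive indices. *)
Lemma contract_mul_bracket (f g : {linear A -> A}) w v :
    (forall b, w * f b - f (w * b) = f b * v - g b) ->
  forall r, contract f (r * br w) = contract f r * v - contract g r.
Proof.
move=> fg; elim/env_ind => [r s IHr IHs|a b].
  by rewrite mulrDl (linearD (contract f)) IHr IHs !linearD mulrDl /= addrACA.
by rewrite env_mul_bracket raddfB /= !contractE -!mulrA -!mulrBr fg.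
Qed.

Variables (x y : A) (h : {poly k}).
Hypothesis yx : y * x = x * y + horner_alg x h.
Local Notation S := {poly k}.
Local Notation iota := (horner_alg x).
Local Notation Phi := (normal_form x y).
Variable kappa : A -> {poly S}.
Hypothesis kappaK : cancel kappa Phi.
Hypothesis normal_formK : cancel Phi kappa.

Lemma kappaD : {morph kappa : a b / a + b}.
Proof.
by move=> a b; apply: (can_inj normal_formK); rewrite raddfD /= !kappaK.
Qed.

Lemma kappaZ c a : kappa (c *: a) = c%:P *: kappa a.
Proof.
apply: (can_inj normal_formK); rewrite normal_formZ !kappaK horner_algC.
by rewrite -scalerAl mul1r.
Qed.

Lemma kappa_x a : kappa (x * a) = x_op (kappa a).
Proof. by rewrite -{1}[a]kappaK normal_form_x normal_formK. Qed.

Lemma kappa_y a : kappa (y * a) = y_op h (kappa a).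
Proof. by rewrite -{1}[a]kappaK (normal_form_y yx) normal_formK. Qed.

(** The induced [theta j] multiplies the first tensor factor by the coefficient of [y^j] in the
    second. It vanishes on the left ideal of [br x] and serves as a coordinate modulo that ideal. *)
Let theta0 j (a : A) : A := iota (kappa a)`_j.
Let theta0_linear j : linear (theta0 j).
Proof.
move=> c a b; rewrite /theta0 kappaD kappaZ coefD coefZ rmorphD rmorphM /=.
by rewrite horner_algC -scalerAl mul1r.
Qed.
Let theta j : {linear R -> A} := contract (linear_of (theta0_linear j)).

(** The induced [coord i j] are the coordinates of [R], as a left [A]-module, on the tensors of 1
    with [x^i y^j]. *)
Let coord0 i j (a : A) : A := ((kappa a)`_j)`_i *: 1.
Let coord0_linear i j : linear (coord0 i j).
Proof.
move=> c a b; rewrite /coord0 kappaD kappaZ !coefD coefZ coefCM scalerDl.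
by rewrite scalerA.
Qed.
Let coord i j : {linear R -> A} := contract (linear_of (coord0_linear i j)).

Let theta_x j r : theta j (r * br x) = 0.
Proof.
rewrite (@contract_mul_bracket (linear_of (theta0_linear j))
  (linear_of (theta0_linear j)) x 1).
  by rewrite mulr1 subrr.
move=> b; rewrite /= /theta0 kappa_x mulr1 subrr coefZ rmorphM /= horner_algX.
by rewrite subrr.
Qed.

(** The derivative term in [y_op] cancels the one produced by moving [y] past a polynomial in
    [x]. *)
Let theta_y j r : theta j.+1 (r * br y) = theta j.+1 r * y - theta j r.
Proof.
apply: contract_mul_bracket => b; rewrite /= /theta0 kappa_y /y_op.
rewrite coefD coefXM coefZ coef_deriv_coefs /= rmorphD opprD addrA addrAC.
congr (_ - _); rewrite (y_horner_alg yx) addrK.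
by [].
Qed.

Let coord_x i j r : coord i.+1 j (r * br x) = coord i.+1 j r * x - coord i j r.
Proof.
apply: contract_mul_bracket => b; rewrite /= /coord0 kappa_x /x_op.
by rewrite coefZ coefXM /= -scalerAr -scalerAl mulr1 mul1r.
Qed.

Let coord_bound r : exists N, forall i j, (N <= i)%N -> coord i j r = 0.
Proof.
elim/env_ind: r => [r s [N rN] [N' sN']|a b].
  exists (maxn N N') => i j; rewrite geq_max => /andP[Ni Ni'].
  by rewrite raddfD /= rN // sN' // addr0.
have [N [_ pN]] := size_coefs (kappa b); exists N => i j Ni.
rewrite contractE /= /coord0 [_`_i]nth_default ?scale0r ?mulr0 //.
exact: leq_trans (pN j) Ni.
Qed.

Let theta_bound r : exists N, forall j, (N <= j)%N -> theta j r = 0.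
Proof.
elim/env_ind: r => [r s [N rN] [N' sN']|a b].
  exists (maxn N N') => i; rewrite geq_max => /andP[Ni Ni'].
  by rewrite raddfD /= rN // sN' // addr0.
exists (size (kappa b)) => j Nj.
by rewrite contractE /= /theta0 nth_default // rmorph0 mulr0.
Qed.

Let coord_expansion r : exists N, forall n, (N <= n)%N ->
  r = \sum_(i < n) \sum_(j < n) env (coord i j r) (x ^+ i * y ^+ j).
Proof.
elim/env_ind: r => [r s [N rN] [N' sN']|a b].
  exists (maxn N N') => n; rewrite geq_max => /andP[Nn Nn'].
  rewrite {1}(rN n Nn) {1}(sN' n Nn') -big_split; apply: eq_bigr => i _ /=.
  by rewrite -big_split; apply: eq_bigr => j _ /=; rewrite raddfD /= envDl.
have [N [bN pN]] := size_coefs (kappa b); exists N => n Nn.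
rewrite -{1}[b]kappaK (normal_form_sum _ _ (leq_trans bN Nn)) exchange_big env_sumr.
apply: eq_bigr => j _; rewrite (horner_alg_sum _ (leq_trans (pN j) Nn)) mulr_suml.
rewrite env_sumr; apply: eq_bigr => i _.
by rewrite contractE /= /coord0 -scalerAr mulr1 -scalerAl envZl envZr.
Qed.

(** If [r * br x = 0], then [coord_x] expresses [coord i j r] through [coord i.+1 j r]; descent from
    large [i] kills all coordinates. *)
Lemma bracket_x_regular r : r * br x = 0 -> r = 0.
Proof.
move=> rx; have E i j : coord i j r = 0.
  have [N rN] := coord_bound r; apply: (@downward_ind (fun i => coord i j r = 0) N).
    by move=> n; exact: rN.
  move=> n rn; have := coord_x n j r; rewrite rx linear0 rn mul0r sub0r.
  by move/esym/eqP; rewrite oppr_eq0 => /eqP.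
have [N rN] := coord_expansion r; rewrite (rN N) // big1 // => i _.
by rewrite big1 // => j _; rewrite E env0l.
Qed.

(** Modulo the left ideal of [br x], polynomials in [x] move across the tensor sign. *)
Lemma env_horner_alg s a b : exists c,
  env a (iota s * b) = env (a * iota s) b + c * br x.
Proof.
elim/poly_ind: s a b => [|s t IH] a b.
  by exists 0; rewrite rmorph0 !(mul0r, mulr0) env0l env0r addr0.
have [c E] := IH a (x * b); rewrite rmorphD rmorphM /= horner_algX horner_algC.
exists (c - env (a * iota s) b).
rewrite mulrBl env_mul_bracket opprB mulrDl mulrDr envDl envDr -!mulrA E.
rewrite -!scalerAl -scalerAr mul1r mulr1 envZl envZr.
by rewrite [RHS]addrAC; congr (_ + _); rewrite [RHS]addrC -addrA subrK addrC.
Qed.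

Let theta_expansion r : exists N, forall n, (N <= n)%N -> exists c,
  r = \sum_(j < n) env (theta j r) (y ^+ j) + c * br x.
Proof.
elim/env_ind: r => [r s [N rN] [N' sN']|a b].
  exists (maxn N N') => n; rewrite geq_max => /andP[Nn Nn'].
  have [c rc] := rN n Nn; have [c' sc'] := sN' n Nn'.
  exists (c + c'); rewrite {1}rc {1}sc' addrACA -mulrDl -big_split; congr (_ + _).
  by apply: eq_bigr => i _ /=; rewrite raddfD /= envDl.
exists (size (kappa b)) => n Nn.
rewrite -{1}[b]kappaK (normal_form_sum _ _ Nn) env_sumr.
have /choice[c cE] : forall j : 'I_n, exists c, env a (iota (kappa b)`_j * y ^+ j) =
    env (theta j (env a b)) (y ^+ j) + c * br x.
  move=> j; have [c cE] := env_horner_alg (kappa b)`_j a (y ^+ j).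
  by exists c; rewrite cE contractE.
by exists (\sum_j c j); rewrite mulr_suml -big_split; apply: eq_bigr => j _; rewrite cE.
Qed.

(** The same descent as for [br x], now modulo the left ideal of [br x] and with the coordinates
    [theta j]. *)
Lemma bracket_y_regular r s : r * br y = s * br x -> exists c, r = c * br x.
Proof.
move=> rs; have E j : theta j r = 0.
  have [N rN] := theta_bound r.
  apply: (@downward_ind (fun j => theta j r = 0) N) => // n rn.
  have := theta_y n r; rewrite rs theta_x rn mul0r sub0r.
  by move/esym/eqP; rewrite oppr_eq0 => /eqP.
have [N rN] := theta_expansion r; have [c ->] := rN N (leqnn N).
by exists c; rewrite big1 ?add0r // => j _; rewrite E env0l.
Qed.

(** By the Leibniz rule, brackets of products lie in the left ideal generated by the brackets of the
    factors, and [x], [y] generate [A]. *)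
Lemma bracket_left_ideal a : exists b c, br a = b * br x + c * br y.
Proof.
have D := bracketD (envDl 1) (envDr 1).
have M := bracketM envM1l envM1r env1C.
have iM s : exists b, br (iota s) = b * br x.
  elim/poly_ind: s => [|s t [b E]].
    by exists 0; rewrite rmorph0 (bracket0 envZ1) mul0r.
  exists (env 1 x * b + env (iota s) 1).
  rewrite rmorphD rmorphM /= horner_algX horner_algC D (bracketZ1 envZ1) addr0 M E.
  by rewrite mulrDl mulrA.
rewrite -[a]kappaK; elim/poly_ind: (kappa a) => [|p s [b [c E]]].
  by exists 0, 0; rewrite raddf0 (bracket0 envZ1) !mul0r addr0.
have [e eE] := iM s; exists (env 1 y * b + e), (env 1 y * c + env (Phi p) 1).
rewrite raddfD /= normal_formMX normal_formC D M E eE mulrDr !mulrDl !mulrA.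
by rewrite -!addrA; congr (_ + _); rewrite addrC -!addrA addrC -!addrA.
Qed.

(** [contract idfun] is the multiplication map. Since [env a b = env (a * b) 1 - env a 1 * br b],
    its kernel is generated by brackets. *)
Lemma env_mul_exact r :
  contract idfun r = 0 <->
  exists b c, b * br x + c * br y = r.
Proof.
pose m := contract idfun.
have m_br w s : m (s * br w) = 0.
  rewrite (@contract_mul_bracket idfun idfun w 1).
    by rewrite mulr1 subrr.
  by move=> b /=; rewrite mulr1 !subrr.
split=> [mr|[b [c <-]]]; last by rewrite -/m raddfD /= !m_br addr0.
have : exists b c, r = env (m r) 1 + (b * br x + c * br y).
  elim/env_ind: r {mr} => [r s [b [c E]] [b' [c' E']]|a b].
    exists (b + b'), (c + c').
    by rewrite {1}E {1}E' addrACA raddfD /= envDl !mulrDl [X in _ + X]addrACA.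
  have [e [f E]] := bracket_left_ideal b.
  exists (- env a 1 * e), (- env a 1 * f).
  rewrite /m contractE /= -!mulrA -mulrDr -E mulNr env_mul_bracket mulr1.
  by rewrite opprB addrC subrK.
by case=> b [c E]; exists b, c; rewrite E /m mr env0l add0r.
Qed.

(** * Cohomology of the complex [A -> A^2 -> A] *)

Section Cohomology.
Hypothesis env11 : env 1 1 = 1.
Hypothesis char0 : [pchar k] =i pred0.
Hypothesis h_neq0 : h != 0.

Variables (N : lmodType R) (phi : A -> N) (psi : N -> A).
Hypothesis phiK : cancel phi psi.
Hypothesis psiK : cancel psi phi.
Hypothesis phiD : {morph phi : a b / a + b}.
Hypothesis env_act : forall a b u, env a b *: phi u = phi (a * u * b).

Let phi0 : phi 0 = 0.
Proof. by apply: (addIr (phi 0)); rewrite -phiD !add0r. Qed.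

Let phiN a : phi (- a) = - phi a.
Proof. by apply/eqP; rewrite -addr_eq0 -phiD addNr phi0. Qed.

Let phiB a b : phi (a - b) = phi a - phi b.
Proof. by rewrite phiD phiN. Qed.

Let psiD : {morph psi : m n / m + n}.
Proof. by move=> m n; apply: (can_inj phiK); rewrite phiD !psiK. Qed.

Let scale_phi (c : k) a : (c%:A : R) *: phi a = phi (c *: a).
Proof. by rewrite -env11 -envZl env_act mulr1 -scalerAl mul1r. Qed.

Let psi_scale (c : k) (n : restrict_scalars N) : psi (c *: n) = c *: psi n.
Proof.
rewrite -[n in LHS]psiK /= -[c *: _]/((c%:A : R) *: phi (psi n)).
by rewrite scale_phi phiK.
Qed.

Let br_act a u : br a *: phi u = phi (a * u - u * a).
Proof. by rewrite /bracket scalerBl !env_act mulr1 mul1r phiB. Qed.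

Lemma kappaB : {morph kappa : a b / a - b}.
Proof.
by move=> a b; apply: (can_inj normal_formK); rewrite normal_formD normal_formN !kappaK.
Qed.

Lemma kappa_iota s a : kappa (iota s * a) = s *: kappa a.
Proof. by apply: (can_inj normal_formK); rewrite normal_formZ !kappaK. Qed.

Lemma kappaC s : kappa (iota s) = s%:P.
Proof. by rewrite -(normal_formC x y) normal_formK. Qed.

Lemma iota_dvd s a : (exists b, a = iota s * b) <-> (forall j, s %| (kappa a)`_j).
Proof.
rewrite -dvdp_coefs; split=> [[b ->]|[q aq]].
  by exists (kappa b); rewrite kappa_iota.
by exists (Phi q); rewrite -normal_formZ -aq kappaK.
Qed.

Lemma x_commutator_dvd a : exists b, x * a - a * x = iota h * b.
Proof.
rewrite -[a]kappaK (normal_form_x_bracket yx (leqnn _)).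
by eexists; rewrite -normal_formN -scalerN; exact: normal_formZ.
Qed.

Lemma y_commutator a : y * a - a * y = iota h * Phi (deriv_coefs (kappa a)).
Proof. by rewrite -{1 2}[a]kappaK (normal_form_y_bracket yx) normal_formZ. Qed.

(** If [a] had degree [n.+1] in [y], the coefficient of [y^n] in the quotient of [[a, x]] by [h]
    would be [n.+1] times the leading one, hence nonzero. *)
Lemma x_commutator_eq0 a : x * a - a * x = 0 <-> exists s, a = iota s.
Proof.
split=> [xa|[s ->]]; last first.
  by rewrite -{1 4}(horner_algX x) -!rmorphM /= mulrC subrr.
exists (kappa a)`_0; rewrite -(normal_formC x y) -[LHS]kappaK; congr (Phi _).
apply: size1_polyC; rewrite leqNgt; apply/negP => sz.
case E: (size (kappa a)) sz => [|[|n]] // _.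
have := normal_form_x_bracket (p := kappa a) (n := n.+2) yx; rewrite E => /(_ (leqnn _)).
rewrite kappaK xa => /esym/eqP.
rewrite oppr_eq0 -(normal_form0 x y) (can_eq normal_formK).
rewrite -mul_polyC mulf_eq0 polyC_eq0 (negPf h_neq0) => /eqP xb0.
have := lead_x_bracket h (kappa a) n; rewrite xb0 coef0 => /esym/eqP.
rewrite mulf_eq0 -polyC_natr polyC_eq0 ((pcharf0P k).1 char0) /=.
have := lead_coef_eq0 (kappa a); rewrite lead_coefE E => ->.
by rewrite -size_poly_eq0 E.
Qed.

Lemma x_commutator_surj b : exists a, x * a - a * x = iota h * b.
Proof.
rewrite -[b]kappaK -normal_formZ.
suff H n (q : {poly S}) : (size q <= n)%N ->
  exists p, x * Phi p - Phi p * x = Phi (h *: q).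
  by have [p ?] := H _ (kappa b) (leqnn _); exists (Phi p).
elim: n q => [|n IH] q.
  rewrite leqn0 size_poly_eq0 => /eqP ->; exists 0.
  by rewrite scaler0 normal_form0 mulr0 mul0r subrr.
(* Bracketing [x] with [- y^(n+1) / (n+1)], weighted by the top coefficient of [q], reproduces the
   top term of [h q]; the induction hypothesis absorbs the rest. *)
move=> qn; pose c : S := (n.+1%:R^-1 : k)%:P * q`_n.
pose p : {poly S} := - (c *: 'X^(n.+1)).
have pE i : p`_i = - (c * (i == n.+1)%:R) by rewrite coefN coefZ coefXn.
have pn : (size p <= n.+2)%N.
  by apply/leq_sizeP => i ni; rewrite pE gtn_eqF // mulr0 oppr0.
have [|p' p'E] := IH (q + x_bracket h p n.+2).
  apply/leq_sizeP => i; rewrite leq_eqVlt => /predU1P[<-|ni].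
    rewrite coefD lead_x_bracket pE eqxx mulr1 mulrN /c mulrA -polyC_natr -polyCM.
    by rewrite divff ?mul1r ?subrr // ((pcharf0P k).1 char0).
  rewrite coefD !nth_default ?addr0 //; first exact: leq_trans (size_x_bracket _ _ _) ni.
  exact: leq_trans qn ni.
exists (p' + p); rewrite normal_formD mulrDr mulrDl opprD addrACA p'E.
by rewrite (normal_form_x_bracket yx pn) scalerDr normal_formD addrK.
Qed.

Let bracket_x_act (u : N) : exists v, br x *: u = env (iota h) 1 *: v.
Proof.
have [b E] := x_commutator_dvd (psi u); exists (phi b).
by rewrite -[u]psiK br_act E env_act mulr1.
Qed.

(** The commutator with [y] also takes values in [h A], so only [- h'] survives of the action of [W]
    modulo [h A]. *)
Lemma koszul_relation_act : exists W : R,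
  W * br x = br x * br y /\
  forall a, exists b, W *: phi a = phi (iota h * b - iota h^`() * a).
Proof.
have [W [WU WN]] := koszul_relation (envDl 1) (envDr 1) envM1l envM1r env1C envZ1
  yx bracket_x_act.
exists W; split=> // a; have [v ->] := WN (phi a).
exists (Phi (deriv_coefs (kappa a)) - psi v).
rewrite br_act y_commutator -[v]psiK !env_act !mulr1 -!phiB phiK; congr phi.
by rewrite mulrBr addrAC.
Qed.

Let eps_linear : linear (fun r : R^o => (r : R) *: phi 1).
Proof. by move=> c r s; rewrite scalerDl scalerA. Qed.
Let eps : {linear R^o -> N} := linear_of eps_linear.

Let epsE r : eps r = phi (contract idfun r).
Proof.
elim/env_ind: r => [r s IHr IHs|a b]; first by rewrite !linearD IHr IHs phiD.
by rewrite /= env_act contractE mulr1.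
Qed.

Let eps_surj m : exists r, eps r = m.
Proof. by exists (env (psi m) 1); rewrite epsE contractE mulr1 psiK. Qed.

Let eps_exact (r : R) : eps r = 0 <-> exists b c : R, b * br x + c * br y = r.
Proof.
rewrite -env_mul_exact epsE; split=> [r0|->] //.
by apply: (can_inj phiK); rewrite r0.
Qed.

Local Notation kN := (restrict_scalars N).

Let psi_linear (c : k) (m n : kN) : psi (c *: m + n) = c *: psi m + psi n.
Proof. by rewrite -psi_scale; exact: psiD. Qed.

Let kappa_psi_linear (c : k) (m n : kN) :
  kappa (psi (c *: m + n)) = c%:P *: kappa (psi m) + kappa (psi n).
Proof. by rewrite psi_linear kappaD kappaZ. Qed.

Let br_eq0 a (n : N) : br a *: n = 0 <-> a * psi n - psi n * a = 0.
Proof. by rewrite -{1}[n]psiK br_act -phi0; split=> [/(can_inj phiK)|->]. Qed.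

(** This is the centre: commuting with [x] forces an element [s] of [k[x]], and commuting with [y]
    then forces [h s' = 0], so [s] is constant. *)
Theorem Ext0_Ore : lin_iso (Ext 0 N N) k^o.
Proof.
have [W [WU _]] := koszul_relation_act.
have gL : linear (fun n : kN => ((kappa (psi n))`_0)`_0 : k^o).
  by move=> c m n; rewrite kappa_psi_linear !coefD coefZ coefCM.
apply: (Ext0_koszul WU eps_surj eps_exact bracket_x_regular bracket_y_regular
  (g := linear_of gL)) => [c|n].
  exists (phi (c *: 1)); split.
  - by apply/br_eq0; rewrite phiK -scalerAr -scalerAl mulr1 mul1r subrr.
  - by apply/br_eq0; rewrite phiK -scalerAr -scalerAl mulr1 mul1r subrr.
  by rewrite /= phiK -(horner_algC x) kappaC coefC eqxx coefC.
move=> /br_eq0/x_commutator_eq0[s nE] /br_eq0; rewrite y_commutator nE kappaC /=.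
rewrite nE kappaC !coefC /= => hs s0.
have : h *: deriv_coefs s%:P = 0.
  by apply: (can_inj normal_formK); rewrite normal_formZ normal_form0.
move/(congr1 (fun p : {poly S} => p`_0)); rewrite coefZ coef0 coef_deriv_coefs coefC /=.
move/eqP; rewrite mulf_eq0 (negPf h_neq0) => /eqP/(deriv_eq0 char0) sE.
by rewrite -[n]psiK nE sE s0 rmorph0 phi0.
Qed.

Theorem Ext2_Ore : lin_iso (Ext 2 N N) (polys_in_y (poly_quotient (gcdp h h^`()))).
Proof.
have [W [WU WN]] := koszul_relation_act.
set d := gcdp h h^`().
pose f : {linear S -> poly_quotient d} := ideal_class (fun r => r = d).
have gL : linear (fun n : kN => map_in_y f (kappa (psi n))).
  by move=> c m n; rewrite kappa_psi_linear map_in_y_linear.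
apply: (Ext2_koszul WU eps_surj eps_exact bracket_x_regular bracket_y_regular
  (g := linear_of gL)) => [w|n].
  have [u|p [_ <-]] := @map_in_y_surj _ _ f (fun=> True) Logic.I _ w.
    by have [s ->] := ideal_class_surj u; exists s.
  by exists (phi (Phi p)); rewrite /= phiK normal_formK.
rewrite /= map_in_y_eq0.
have -> : (forall j, f (kappa (psi n))`_j = 0) <-> exists b, psi n = iota d * b.
  by rewrite iota_dvd; split=> dn j; apply/poly_class_eq0/dn.
have ann s b : h %| s \/ h^`() %| s -> exists c, iota s * b = iota d * c.
  move=> hs; have /dvdpP[t ->] : d %| s.
    by case: hs; apply: dvdp_trans; rewrite ?dvdp_gcdl ?dvdp_gcdr.
  by exists (iota t * b); rewrite mulrC rmorphM mulrA.
split=> [[b nb]|[u [v nE]]].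
  have [s [t dE]] := gcdp_Bezout h h^`().
  (* In [d = s h + t h'], the part [t h'] comes from [W]; the discrepancy lies in [h A] and is a
     commutator with [x]. *)
  have [e We] := WN (- (iota t * b)).
  have [c cE] := x_commutator_surj (e - iota s * b).
  exists (phi (- (iota t * b))), (phi c).
  rewrite We br_act cE -phiB -[n]psiK nb; congr phi.
  rewrite /d dE mulrN opprK mulrBr opprB [_ + (_ - _)]addrC addrA subrK.
  by rewrite !mulrA -!rmorphM -mulrDl -rmorphD /=; congr (iota _ * b); ring.
have [b Wb] := WN (psi u); have [c cE] := x_commutator_dvd (psi v).
have [e eE] := ann h b (or_introl (dvdpp _)).
have [e' eE'] := ann h^`() (psi u) (or_intror (dvdpp _)).
have [e'' eE''] := ann h c (or_introl (dvdpp _)).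
exists (e - e' - e''); rewrite nE -[u]psiK Wb -[v]psiK br_act cE -phiB phiK.
by rewrite eE eE' eE'' !mulrBr.
Qed.

Theorem Ext_ge3_Ore n : (2 < n)%N -> forall z : Ext n N N, z = 0.
Proof.
have [W [WU _]] := koszul_relation_act.
exact: (Ext_ge3_koszul WU eps_surj eps_exact bracket_x_regular bracket_y_regular).
Qed.

(** In a cocycle [(u, v)], [v] is determined by [u] up to the kernel [k[x]] of [[x, -]], hence the
    first summand; [u] itself matters only modulo [h A], the image of [[x, -]]. *)
Theorem Ext1_Ore : lin_iso (Ext 1 N N)
  (poly_quotient h * polys_in_y (poly_quotient_ideal h (h %/ gcdp h h^`())))%type.
Proof.
have [W [WU WN]] := koszul_relation_act.
set e := h %/ gcdp h h^`().
pose I := poly_quotient_ideal h e.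
pose cls : {linear S -> poly_quotient h} := ideal_class (fun r => r = h).
pose f : {linear S -> I} := linear_of (@to_quotient_ideal_linear _ h e).
have gL : linear (fun mn : (kN * kN)%type =>
    (cls (kappa (psi mn.2))`_0, map_in_y f (kappa (psi mn.1))) :
      (poly_quotient h * polys_in_y I)%type).
  move=> c m n; congr pair; rewrite /= kappa_psi_linear ?map_in_y_linear //.
  by rewrite coefD coefZ mul_polyC linearP.
(* [W] sends [a] into [h A - h' a], and commutators with [x] fill [h A], so a partner [b] exists
   exactly when [h] divides every coefficient of [h' a]. *)
have cocycle_dvd a : (exists b, W *: phi a = br x *: phi b) <->
    (forall j, e %| (kappa a)`_j).
  have -> : (forall j, e %| (kappa a)`_j) <->
      (forall j, h %| (kappa (iota h^`() * a))`_j).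
    by split=> ea j; move: (ea j); rewrite kappa_iota coefZ dvdp_deriv_coprime.
  rewrite -iota_dvd; have [c ->] := WN a; split=> [[b]|[b E]].
    rewrite br_act => /(can_inj phiK) E; have [b' E'] := x_commutator_dvd b.
    by exists (c - b'); rewrite mulrBr -E' -E opprB addrC subrK.
  have [b' E'] := x_commutator_surj (c - b).
  by exists b'; rewrite br_act E' mulrBr E.
apply: (Ext1_koszul WU eps_surj eps_exact bracket_x_regular bracket_y_regular
  (g := linear_of gL)) => [[w0 w]|u v Wuv].
  have [s ->] := ideal_class_surj w0.
  have [||p [ep <-]] := @map_in_y_surj _ _ f (fun s => e %| s) _ _ w.
  - exact: dvdp0.
  - exact: to_quotient_ideal_surj.
  have [|b Wb] := (cocycle_dvd (Phi p)).2; first by move=> j; rewrite normal_formK.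
  (* Adding a polynomial in [x] to the partner preserves the cocycle condition and lets its constant
     coefficient in [y] be prescribed. *)
  exists (phi (Phi p)), (phi (b + iota (s - (kappa b)`_0))); split.
    rewrite Wb !br_act; congr phi; rewrite mulrDr mulrDl opprD addrACA.
    set t := s - _; have -> : x * iota t - iota t * x = 0.
      by apply/x_commutator_eq0; exists t.
    by rewrite addr0.
  by rewrite /= !phiK normal_formK kappaD kappaC coefD coefC /= addrC subrK.
have /cocycle_dvd eu : exists b, W *: phi (psi u) = br x *: phi b.
  by exists (psi v); rewrite !psiK.
have -> : linear_of gL (u, v) = 0 <->
    h %| (kappa (psi v))`_0 /\ exists b, psi u = iota h * b.
  rewrite iota_dvd; split=> [[/poly_class_eq0 hv /map_in_y_eq0 hu]|[hv hu]].
    by split=> // j; apply/(to_quotient_ideal_eq0 _ (eu j))/hu.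
  congr pair; first exact/poly_class_eq0.
  by apply/map_in_y_eq0 => j; apply/(to_quotient_ideal_eq0 _ (eu j))/hu.
split=> [[hv [b ub]]|[n [-> ->]]]; last first.
  rewrite -[n]psiK !br_act !phiK y_commutator kappa_iota coefZ dvdp_mulr //; split=> //.
  exact: x_commutator_dvd.
(* Once [u = [x, a]], the relation [W U = U V] makes [v - [y, a]] commute with [x], so it is some
   [s] in [k[x]]. *)
have [a aE] := x_commutator_surj b.
have uE : u = br x *: phi a by rewrite br_act aE -ub psiK.
have [s sE] : exists s, psi v - (y * a - a * y) = iota s.
  apply/x_commutator_eq0; apply: (can_inj phiK); rewrite phi0 -br_act phiB.
  by rewrite -br_act scalerBr psiK -Wuv uE !scalerA WU subrr.
have hs : h %| s.
  have /(congr1 (fun p : {poly S} => p`_0)) := congr1 kappa sE.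
  rewrite kappaB y_commutator kappaC kappa_iota coefB coefZ coefC /= => <-.
  by rewrite dvdp_sub // dvdp_mulr.
(* Then [[y, t] = h t' = s], so replacing [a] by [a + t] corrects [v] without changing [[x, a]]. *)
have [t tE] := deriv_surj char0 (s %/ h).
exists (phi (a + iota t)); split.
  rewrite uE !br_act; congr phi; rewrite mulrDr mulrDl opprD addrACA.
  have -> : x * iota t - iota t * x = 0 by apply/x_commutator_eq0; exists t.
  by rewrite addr0.
rewrite br_act -[v]psiK; congr phi; rewrite mulrDr mulrDl opprD addrACA.
rewrite (y_horner_alg yx) tE mulrC divpK // [_ + iota s]addrC addrK -sE addrC.
by rewrite subrK.
Qed.

End Cohomology.

End TensorAlgebra.

(** * The algebra [A_h] *)

Section ActionOnNormalForms.
Variables (k : fieldType) (h : {poly k}) (B : algType k) (x y : B).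
Local Notation S := {poly k}.
Variable act : B -> {poly S} -> {poly S}.
Hypothesis actD : forall a b p, act (a + b) p = act a p + act b p.
Hypothesis actM : forall a b p, act (a * b) p = act a (act b p).
Hypothesis actZ1 : forall c p, act (c *: 1) p = c%:P *: p.
Hypothesis act_x : forall p, act x p = x_op p.
Hypothesis act_y : forall p, act y p = y_op h p.

Let act0 p : act 0 p = 0.
Proof. by apply: (addIr (act 0 p)); rewrite -actD !add0r. Qed.

Let actN a p : act (- a) p = - act a p.
Proof. by apply/eqP; rewrite -addr_eq0 -actD addNr act0. Qed.

Lemma act_horner_alg s p : act (horner_alg x s) p = s *: p.
Proof.
elim/poly_ind: s p => [|s c IH] p; first by rewrite rmorph0 act0 scale0r.
rewrite rmorphD rmorphM /= horner_algX horner_algC actD actM act_x IH actZ1.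
by rewrite scalerA scalerDl.
Qed.

Lemma act_Ore_relation p : act (y * x - x * y - horner_alg x h) p = 0.
Proof.
rewrite !(actD, actN, actM) !act_x !act_y act_horner_alg /x_op /y_op.
apply/polyP => i.
rewrite !(coefD, coefN, coefZ, coefXM, coef_deriv_coefs) derivM derivX coef0.
case: (i == 0%N); ring.
Qed.

(** Acting on 1, the case [m = 0], recovers [p] from its normal form. General [m] is needed because
    the induction removes factors [y] on the right, each raising the exponent. *)
Lemma act_normal_form p m : act (normal_form x y p) 'X^m = p * 'X^m.
Proof.
elim/poly_ind: p m => [|p s IH] m; first by rewrite normal_form0 act0 mul0r.
rewrite normal_formD normal_formMX normal_formC actD actM act_y act_horner_alg.
have -> : y_op h 'X^m = 'X^(m.+1).
  rewrite /y_op -exprS; apply/polyP => i; rewrite coefD coefZ coef_deriv_coefs !coefXn.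
  rewrite (_ : ((i == m)%:R)^`() = 0) ?mulr0 ?addr0 //.
  by case: (i == m); rewrite ?derivC.
by rewrite IH exprS mulrA mulrDl mul_polyC.
Qed.

End ActionOnNormalForms.

Lemma morph_horner_alg (k : fieldType) (B A : algType k) (f : B -> A) (b : B) s :
    {morph f : u v / u + v} -> {morph f : u v / u * v} ->
    (forall c : k, f (c *: 1) = c *: 1) ->
  f (horner_alg b s) = horner_alg (f b) s.
Proof.
move=> fD fM fZ; have f0 : f 0 = 0 by apply: (addIr (f 0)); rewrite -fD !add0r.
elim/poly_ind: s => [|s c IH]; first by rewrite !rmorph0.
by rewrite !rmorphD !rmorphM /= !horner_algX !horner_algC fD fM fZ IH.
Qed.

Lemma free_algebra_ind (k : comNzRingType) (I : choiceType)
    (P : free_algebra k I -> Prop) :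
    (forall c f g, P f -> P g -> P (c *: f + g)) -> P 1 ->
    (forall i f, P f -> P (free_algebra_gen k i * f)) ->
  forall f, P f.
Proof.
move=> PL P1 PM f.
have P0 : P 0 by have := PL (-1) _ _ P1 P1; rewrite scaleN1r addNr.
rewrite (monalgE f); elim/big_rec: _ => // w g _ Pg.
have -> : (<< f@_w *g w >> : free_algebra k I) = f@_w *: (<< w >> : free_algebra k I).
  by apply/malgP => v; rewrite mcoeffZ !mcoeffU; case: eqP; rewrite ?mulr1 ?mulr0.
apply: PL => //; rewrite -[w]fmK.
elim: (w : seq I) => [|i s IH].
  by have -> : FMonom [::] = mone :> {fmonom I} by apply/val_inj; rewrite /= fm1.
have -> : (<< FMonom (i :: s) >> : free_algebra k I) =
    free_algebra_gen k i * << FMonom s >>.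
  rewrite /free_algebra_gen malgM_def fgmulUU mulr1.
  by congr << _ >>; apply/val_inj; rewrite /= fmM fmU.
exact: PM.
Qed.

Section OreAlgebra.
Variables (k : fieldType) (h : {poly k}).
Local Notation S := {poly k}.
Local Notation F := (free_algebra k bool).
Local Notation A := (Ah h : algType k).

Definition Ah_class (f : F) : A := ideal_class (Ah_rel h) f.
Local Notation x := (Ah_class (free_algebra_gen k false)).
Local Notation y := (Ah_class (free_algebra_gen k true)).

Lemma Ah_classD : {morph Ah_class : f g / f + g}.
Proof. exact: (raddfD (ideal_class (Ah_rel h))). Qed.

Lemma Ah_classM : {morph Ah_class : f g / f * g}.
Proof. exact: ideal_classM. Qed.

Lemma Ah_classZ (c : k) f : Ah_class (c *: f) = c *: Ah_class f.
Proof. exact: (linearZ_LR (ideal_class (Ah_rel h))). Qed.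

Lemma Ah_class1 : Ah_class 1 = 1.
Proof. by []. Qed.

Lemma Ah_class_surj a : exists f, a = Ah_class f.
Proof. exact: ideal_class_surj. Qed.

Lemma Ah_class0 : Ah_class 0 = 0.
Proof. by apply: (addIr (Ah_class 0)); rewrite -Ah_classD !add0r. Qed.

Lemma Ah_classN f : Ah_class (- f) = - Ah_class f.
Proof. by apply/eqP; rewrite -addr_eq0 -Ah_classD addNr Ah_class0. Qed.

Lemma Ah_relation : y * x = x * y + horner_alg x h.
Proof.
have Z (c : k) : Ah_class (c *: 1) = c *: 1 by rewrite Ah_classZ Ah_class1.
apply/eqP; rewrite addrC -subr_eq -subr_eq0; apply/eqP.
rewrite -(morph_horner_alg (free_algebra_gen k false) h Ah_classD Ah_classM Z).
rewrite -!Ah_classM -!Ah_classN -!Ah_classD -Ah_class0.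
by apply/ideal_classP; rewrite subr0; exact: IdealGen.
Qed.

Lemma Ah_ind (P : A -> Prop) :
    (forall c a b, P a -> P b -> P (c *: a + b)) -> P 1 ->
    (forall a, P a -> P (x * a)) -> (forall a, P a -> P (y * a)) ->
  forall a, P a.
Proof.
move=> PL P1 Px Py a; have [f ->] := Ah_class_surj a.
elim/free_algebra_ind: f => [c f g Pf Pg||i f Pf].
- by rewrite Ah_classD Ah_classZ; exact: PL.
- by rewrite Ah_class1.
by rewrite Ah_classM; case: i; [exact: Py|exact: Px].
Qed.

Local Notation M := (restrict_scalars {poly S} : lmodType k).

Let rho (b : bool) (p : M) : M := if b then y_op h p else x_op p.

Let scaleME (c : k) (p : M) : c *: p = c%:P *: (p : {poly S}) :> {poly S}.
Proof. by rewrite -alg_polyC. Qed.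

Let rho_linear b : linear (rho b).
Proof.
move=> c p q; rewrite -[RHS]/(c *: rho b p + rho b q : {poly S}) !scaleME.
rewrite /rho /x_op /y_op; apply/polyP => i; case: b.
  rewrite !(coefD, coefZ, coefXM, coef_deriv_coefs) derivD derivM derivC mul0r add0r.
  by case: (i == 0%N); ring.
by rewrite !(coefD, coefZ); ring.
Qed.

Let Ah_action (a : A) (p : {poly S}) : {poly S} :=
  quot_lift (fun f : F => free_action rho f p) a.

Let Ah_actionE f p : Ah_action (Ah_class f) p = free_action rho f p.
Proof.
apply: (quot_liftE (f := fun f : F => free_action rho f p)) => f1 f2 I12.
apply/eqP; rewrite -subr_eq0 -free_actionB; apply/eqP.
apply: (free_action_ideal rho_linear _ I12) => _ -> q.
apply: (act_Ore_relation (act := free_action rho)) => [a b r|a b r|c r|r|r].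
- exact: (free_actionD rho r a b).
- exact: (free_actionM rho_linear a b r).
- by rewrite free_actionZ free_action1 scaleME.
- exact: (free_action_gen rho false r).
exact: (free_action_gen rho true r).
Qed.

(** The inverse sends [a] to its action on 1. One composite is [act_normal_form]; the other follows
    by induction on left multiplication by the generators. *)
Lemma Ah_normal_form : exists kappa : A -> {poly S},
  cancel kappa (normal_form x y) /\ cancel (normal_form x y) kappa.
Proof.
have actD a b p : Ah_action (a + b) p = Ah_action a p + Ah_action b p.
  have [f ->] := Ah_class_surj a; have [g ->] := Ah_class_surj b.
  by rewrite -Ah_classD !Ah_actionE free_actionD.
have actM a b p : Ah_action (a * b) p = Ah_action a (Ah_action b p).
  have [f ->] := Ah_class_surj a; have [g ->] := Ah_class_surj b.
  by rewrite -Ah_classM !Ah_actionE; exact: (free_actionM rho_linear f g p).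
have actZ1 c p : Ah_action (c *: 1) p = c%:P *: p.
  by rewrite -Ah_class1 -Ah_classZ Ah_actionE free_actionZ free_action1 scaleME.
have act_x p : Ah_action x p = x_op p by rewrite Ah_actionE free_action_gen.
have act_y p : Ah_action y p = y_op h p by rewrite Ah_actionE free_action_gen.
exists (fun a => Ah_action a 1); split=> [a|p]; last first.
  by rewrite -(expr0 'X) (act_normal_form actD actM actZ1 act_x act_y) expr0 mulr1.
elim/Ah_ind: a => [c a b Ea Eb||a Ea|a Ea].
- have -> : c *: a = (c *: 1) * a by rewrite -scalerAl mul1r.
  by rewrite actD actM actZ1 normal_formD normal_formZ Ea Eb horner_algC.
- have := actZ1 1 1; rewrite scale1r polyC1 scale1r => ->.
  by rewrite normal_formC rmorph1.
- by rewrite actM act_x -normal_form_x Ea.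
by rewrite actM act_y -(normal_form_y Ah_relation) Ea.
Qed.

End OreAlgebra.

(** * The enveloping algebra and its action on the algebra *)

Section Enveloping.
Variables (k : fieldType) (A : algType k).
Local Notation R := (enveloping A : algType k).

Definition env (a b : A) : R := tens a (b : A^c).

Lemma env_linear_l b : linear (env^~ b).
Proof. exact: tens_linear_l. Qed.

Lemma env_linear_r a : linear (env a).
Proof. exact: tens_linear_r. Qed.

Lemma envM a b c d : env a b * env c d = env (a * c) (d * b).
Proof. exact: tensM. Qed.

Lemma env_ind (P : R -> Prop) :
    (forall r s, P r -> P s -> P (r + s)) -> (forall a b, P (env a b)) ->
  forall r, P r.
Proof.
move=> PD Pe.
have Z (c : k) a b : c *: env a b = env (c *: a) b by rewrite (envZl env_linear_l).
(* [P] is assumed closed under sums only, while tensor induction also scales, so all scalar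
   multiples are carried along. *)
suff H r : P r /\ forall c : k, P (c *: r) by move=> r; have [] := H r.
elim/tensor_ind: r => [|c r s [Pr Pr'] [Ps Ps']|a b].
- have P0 : P 0 by rewrite -(env0l env_linear_l 0).
  by split=> // c; rewrite scaler0.
- split=> [|c']; first exact: PD.
  by rewrite scalerDr; apply: PD => //; rewrite scalerA.
by split=> [|c]; [exact: Pe|rewrite -[tens a b]/(env a b) Z; exact: Pe].
Qed.

Let contract_fun (f : {linear A -> A}) (r : R) : A :=
  tensor_lift (fun a (b : A^c) => a * f b) r.

Let contract_wd_l (f : {linear A -> A}) (b : A^c) :
  linear ((fun a (b : A^c) => a * f b)^~ b).
Proof. by move=> c a a'; rewrite mulrDl scalerAl. Qed.

Let contract_wd_r (f : {linear A -> A}) a : linear ((fun a (b : A^c) => a * f b) a).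
Proof. by move=> c b b'; rewrite (linearP f) mulrDr scalerAr. Qed.

Let contract_linear f : linear (contract_fun f).
Proof. exact: (tensor_lift_linear (contract_wd_l f) (contract_wd_r f)). Qed.

Definition contract (f : {linear A -> A}) : {linear R -> A} :=
  linear_of (contract_linear f).

Lemma contractE f a b : contract f (env a b) = a * f b.
Proof. exact: (tensor_liftE (contract_wd_l f) (contract_wd_r f)). Qed.

Lemma env_act a b u : env a b *: (u : regular_bimodule A) = a * u * b :> A.
Proof. exact: bimod_actionE. Qed.

End Enveloping.

Theorem proposition6p4 (k : fieldType) (char0 : [pchar k] =i pred0)
    (h : {poly k}) (h_neq0 : h != 0) :
  let d := gcdp h h^`() in
  let I := poly_quotient_ideal h (h %/ d) in
  [/\ lin_iso (HH 0 (Ah h)) k^o,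
      lin_iso (HH 1 (Ah h)) (poly_quotient h * polys_in_y I)%type,
      lin_iso (HH 2 (Ah h)) (polys_in_y (poly_quotient d))
    & forall i : nat, (2 < i)%N -> forall z : HH i (Ah h), z = 0].
Proof.
move=> d I; have [kappa [kappaK normal_formK]] := Ah_normal_form h.
have yx := Ah_relation h.
pose N : lmodType (enveloping (Ah h)) := regular_bimodule (Ah h).
(* The algebra and its regular bimodule have the same elements, so identity maps serve as [phi] and
   [psi]. *)
pose to_N : Ah h -> N := id; pose of_N : N -> Ah h := id.
have to_NK : cancel to_N of_N by [].
have of_NK : cancel of_N to_N by [].
have to_ND : {morph to_N : a b / a + b} by [].
have to_N_act a b u : env a b *: to_N u = to_N (a * u * b) by exact: env_act.
have env_lin_l := @env_linear_l k (Ah h).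
have env_lin_r := @env_linear_r k (Ah h).
have env11 : env 1 1 = 1 :> enveloping (Ah h) by exact: tens11.
split.
- exact: (Ext0_Ore env_lin_l env_lin_r (@envM _ _) (@env_ind _ _) (@contractE _ _)
    yx kappaK normal_formK env11 char0 h_neq0 to_NK of_NK to_ND to_N_act).
- exact: (Ext1_Ore env_lin_l env_lin_r (@envM _ _) (@env_ind _ _) (@contractE _ _)
    yx kappaK normal_formK env11 char0 h_neq0 to_NK of_NK to_ND to_N_act).
- exact: (Ext2_Ore env_lin_l env_lin_r (@envM _ _) (@env_ind _ _) (@contractE _ _)
    yx kappaK normal_formK env11 char0 to_NK of_NK to_ND to_N_act).
- exact: (Ext_ge3_Ore env_lin_l env_lin_r (@envM _ _) (@env_ind _ _) (@contractE _ _)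
    yx kappaK normal_formK to_NK of_NK to_ND to_N_act).
Qed.
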